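(* Let $k\geq 2$ and $\tau=k(k-1)\cdots 1\in S_k$, and consider $S_n(\tau)$ with the uniform probability measure $\mathbb{P}^\tau_n$. Then whenever $0<\epsilon<k-2$, $$\lim_{n\to\infty}\mathbb{P}^\tau_n\Big(\mathrm{LIS}_n>\tfrac{1+\epsilon}{k-1}n\Big)^{1/n}=\Big[(1+\epsilon)^{1+\epsilon}\Big(1-\tfrac{\epsilon}{k-2}\Big)^{k-2-\epsilon}\Big]^{-\frac{2}{k-1}},$$ and $\mathbb{P}^\tau_n\big(\mathrm{LIS}_n<\tfrac{n}{k-1}\big)=0$ for every $n$. Consequently $\mathrm{LIS}_n/n\to 1/(k-1)$ in probability as $n\to\infty$.
   Context: $S_n(\tau)$ is the set of permutations of $[n]$ avoiding the pattern $\tau$; $\mathrm{LIS}_n(\sigma)$ is the length of the longest increasing subsequence of $\sigma$. *)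

(* Defs.v *)
From HB Require Import structures.
From mathcomp Require Export all_boot all_order all_fingroup all_algebra.
From mathcomp Require Export all_classical all_reals all_analysis.

Set Implicit Arguments.
Unset Strict Implicit.
Unset Printing Implicit Defensive.

Export Order.TTheory GRing.Theory Num.Theory.
Export numFieldNormedType.Exports.

Local Open Scope ring_scope.

(* Permutations of [n] are 'S_n, so positions and values are shifted from
   {1, ..., n} to {0, ..., n-1}. *)

Definition contains_pattern (n k : nat) (s : 'S_n) (t : 'S_k) : bool :=
  [exists f : {ffun 'I_k -> 'I_n},
     [forall i : 'I_k, forall j : 'I_k, (i < j)%N ==> (f i < f j)%N] &&
     [forall i : 'I_k, forall j : 'I_k, (s (f i) < s (f j))%N == (t i < t j)%N]].

Definition avoiders (n k : nat) (t : 'S_k) : {set 'S_n} :=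
  [set s : 'S_n | ~~ contains_pattern s t].

Definition decreasing_perm (k : nat) : 'S_k := perm (@rev_ord_inj k).

(* A subsequence of s is encoded by its set of positions. *)
Definition increasing_on (n : nat) (s : 'S_n) (A : {set 'I_n}) : bool :=
  [forall i in A, forall j in A, (i < j)%N ==> (s i < s j)%N].

Definition LIS (n : nat) (s : 'S_n) : nat :=
  \max_(A : {set 'I_n} | increasing_on s A) #|A|.

Definition uniform_prob (R : realType) (T : finType) (S : {set T})
    (E : pred T) : R :=
  #|[set x in S | E x]|%:R / #|S|%:R.

Definition avoid_prob (R : realType) (k : nat) (t : 'S_k) (n : nat)
    (E : pred 'S_n) : R :=
  uniform_prob R (avoiders n t) E.
Arguments avoid_prob R {k} t n E.

(* X_n -> l in probability under the uniform measures on S_n(t). *)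
Definition cvg_in_avoid_prob (R : realType) (k : nat) (t : 'S_k)
    (X : forall n : nat, 'S_n -> R) (l : R) : Prop :=
  forall delta : R, 0 < delta ->
    (avoid_prob R t n (fun s => delta < `|X n s - l|) @[n --> \oo] --> (0 : R))%classic.

(* Main.v *)
(* Put d = k - 1. Counting on the exponential scale with d-letter words:

   Upper bounds. Row insertion into a single row (the first row of RSK) turns a
   permutation into a set of positions and a set of values, both at least as large
   as its longest increasing subsequence, and a partial permutation (the bumped
   values) whose longest decreasing subsequence is shorter by one. Iterating d
   times encodes injectively an avoider of k...1 by two words over d letters in
   which the letter 0 occurs at least LIS times. A Chernoff bound counts such words.

   Lower bounds. A pair of words with the same content gives a permutation, by
   matching the occurrences of each letter in order. It is a union of d increasing
   sequences, and the pair can be recovered if every letter i + 1 is preceded by a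
   larger value of letter i while inversions always increase the letter. This holds
   for words made of consecutive blocks of fixed content, in which letter i is
   delayed by i blocks in positions and advanced by i blocks in values, so the count
   is a power of a multinomial coefficient, estimated by the Stirling bounds.

   Both counts of { LIS > c n } are exp (2 n H) with H the entropy of the
   distribution (c, (1-c)/(d-1), ..., (1-c)/(d-1)), and c = 1/d gives d^(2 n) for
   the number of all avoiders. *)

Require Import Defs.
From mathcomp Require Import zify ring lra.

Set Implicit Arguments.
Unset Strict Implicit.
Unset Printing Implicit Defensive.

(** * Row insertion *)

Section Bumping.
Import mathcomp.boot.fintype mathcomp.boot.finset.
Variable m : nat.
Implicit Types (row : {set 'I_m}) (x y z : 'I_m) (S : nat -> option 'I_m).

Definition bump_val row x : option 'I_m :=
  [pick y in row | (x < y)%N & [forall z in row, (x < z)%N ==> (y <= z)%N]].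

Variant bump_val_spec row x : option 'I_m -> Prop :=
| BumpSome y of y \in row & (x < y)%N & (forall z, z \in row -> (x < z)%N -> (y <= z)%N) :
    bump_val_spec row x (Some y)
| BumpNone of (forall z, z \in row -> (z <= x)%N) : bump_val_spec row x None.

Lemma bump_valP row x : bump_val_spec row x (bump_val row x).
Proof.
rewrite /bump_val; case: pickP => [y /and3P[yr xy /forall_inP ymin]|nobump].
  by apply: BumpSome => // z zr xz; have /implyP := ymin z zr; apply.
apply: BumpNone => z zr; rewrite leqNgt; apply/negP => xz.
have zP : (z \in row) && (x < z)%N by rewrite zr.
case: (@arg_minnP _ z (fun y => (y \in row) && (x < y)%N) (@nat_of_ord m) zP)
  => y /andP[yr xy] ymin.
have /negP := nobump y; apply; rewrite /= yr xy /=.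
by apply/forall_inP => w wr; apply/implyP => xw; apply: ymin; rewrite wr.
Qed.

Definition insert row x : {set 'I_m} :=
  x |: (if bump_val row x is Some y then row :\ y else row).

(** A row is increasing, so its set of entries determines it. A stream gives the value inserted at
    each time, or [None]; a bumped value keeps the time of its bump, so [bumped S] is again a stream
    and insertion can be iterated. *)
Fixpoint first_row S (t : nat) : {set 'I_m} :=
  if t is t'.+1 then
    if S t' is Some x then insert (first_row S t') x else first_row S t'
  else set0.

Definition bumped S (t : nat) : option 'I_m :=
  if S t is Some x then bump_val (first_row S t) x else None.

Definition past S (t : nat) x := exists2 t', (t' < t)%N & S t' = Some x.

Definition stream_inj S :=
  forall t t' x, S t = Some x -> S t' = Some x -> t = t'.

Lemma pastS S t x : past S t.+1 x <-> past S t x \/ S t = Some x.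
Proof.
split=> [[t' + St']|[[t' tt' St']|St]].
- by rewrite ltnS leq_eqVlt => /predU1P[<-|tt']; [right | left; exists t'].
- by exists t' => //; rewrite ltnS ltnW.
- by exists t.
Qed.

(** In an injective stream a value enters the row at most once, so once bumped it never returns. *)
Lemma first_row_mem S t x : stream_inj S ->
  x \in first_row S t <-> past S t x /\ ~ past (bumped S) t x.
Proof.
move=> Sinj; elim: t x => [|t IH] x.
  by rewrite inE; split=> // -[[]].
rewrite !pastS /= {2}/bumped; case St: (S t) => [x0|]; last first.
  rewrite IH; split=> [[? nb]|[[?|//] nb]]; split; by [left | case | move=> ?; apply: nb; left | ].
have x0new : ~ past S t x0.
  by case=> t' tt' St'; move: tt'; rewrite (Sinj _ _ _ St' St) ltnn.
have bsub y : past (bumped S) t y -> past S t y.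
  case=> t' tt'; rewrite /bumped; case: (S t') => // z.
  case: bump_valP => // w /[swap] _ /[swap] _ /[swap] [[<-]].
  move=> wr; have : w \in first_row S t' by [].
  elim: t' tt' {wr} => [|t' IHt'] tt'; first by rewrite inE.
  rewrite /=; case St': (S t') => [x1|]; last by apply: IHt'; apply: ltnW.
  rewrite /insert !inE => /orP[/eqP->|]; first by exists t' => //; apply: ltnW.
  by case: bump_valP => [? _ _ _|_]; rewrite ?inE => H;
    (apply: IHt'; [exact: ltnW | by case/andP: H || exact: H]).
have x0row : x0 \notin first_row S t by apply/negP => /IH[].
rewrite /insert !inE; case: bump_valP => [y yr xy ymin|ymax].
  have yx0 : y <> x0 by move=> yx0; rewrite yx0 (negPf x0row) in yr.
  split=> [/orP[/eqP->|]|].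
  - by split; [right | case=> [/bsub//|[/yx0]]].
  - rewrite !inE => /andP[/eqP xny /IH[? ?]].
    by split; [left | case=> [//|[/esym]]].
  - case=> [[px|[->]]]; last by rewrite eqxx.
    move=> H; rewrite !inE; apply/orP; right; apply/andP; split.
      by apply/eqP => xy'; apply: H; right; rewrite xy'.
    by apply/IH; split=> // ?; apply: H; left.
split=> [/orP[/eqP->|/IH[? ?]]|].
- by split; [right | case=> [/bsub//|]].
- by split; [left | case].
- case=> [[px|[->]]]; last by rewrite eqxx.
  by move=> H; apply/orP; right; apply/IH; split=> // ?; apply: H; left.
Qed.

Lemma bumpedP S t y : stream_inj S -> bumped S t = Some y ->
  [/\ y \in first_row S t, past S t y &
      exists x, [/\ S t = Some x, (x < y)%N &
        forall z, z \in first_row S t -> (x < z)%N -> (y <= z)%N]].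
Proof.
move=> Sinj; rewrite /bumped; case St: (S t) => [x|//].
case: bump_valP => // w wr xw wmin [<-]; split=> //; last by exists x.
by have [] := (first_row_mem t w Sinj).1 wr.
Qed.

Lemma bumped_inj S : stream_inj S -> stream_inj (bumped S).
Proof.
move=> Sinj.
have lt t t' y : (t < t')%N -> bumped S t = Some y -> bumped S t' = Some y -> False.
  move=> tt' bt /(bumpedP Sinj)[yr _ _].
  by have [_] := (first_row_mem t' y Sinj).1 yr; apply; exists t.
move=> t t' y bt bt'; case: (ltngtP t t') => // tt'.
  by case: (lt _ _ _ tt' bt bt').
by case: (lt _ _ _ tt' bt' bt).
Qed.

(** A decreasing subsequence of the stream, as a list of pairs of a time and a value. *)
Definition dchain S (l : seq (nat * 'I_m)) :=
  sorted (fun a b : nat * 'I_m => (a.1 < b.1)%N && (b.2 < a.2)%N) l &&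
  all (fun a : nat * 'I_m => S a.1 == Some a.2) l.

Lemma dchain_rcons2 S l a b : dchain S (rcons (rcons l a) b) =
  [&& dchain S (rcons l a), (a.1 < b.1)%N, (b.2 < a.2)%N & S b.1 == Some b.2].
Proof.
rewrite /dchain -!cats1 -catA /= !all_cat /=.
have -> : l ++ [:: a; b] = rcons (rcons l a) b by rewrite -!cats1 -catA.
rewrite cats1; case: l => [|c l]; rewrite /= ?andbT.
  by rewrite -!andbA; do !bool_congr; rewrite andbC.
rewrite rcons_path last_rcons; case: path; rewrite //= ?andbF //.
by case: (S c.1 == _); rewrite /= ?andbF //; case: all; rewrite /= ?andbF //;
  case: (S a.1 == _); rewrite /= ?andbF ?andbT // -?andbA.
Qed.

(* A decreasing chain of bumped values lifts to one of the same length ending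
   earlier and not lower: append either the last bumped value itself, if it was
   inserted after the previous bump, or else the value causing that bump. *)
Lemma dchain_bumped_lift S l i y : stream_inj S ->
  dchain (bumped S) (rcons l (i, y)) ->
  exists l' e, [/\ size l' = size l, dchain S (rcons l' e), (e.1 < i)%N & (y <= e.2)%N].
Proof.
move=> Sinj; elim/last_ind: l i y => [|l [i' y'] IH] i y.
  rewrite /dchain /= andbT => /eqP/(bumpedP Sinj)[_ [t ti St] _].
  by exists [::], (t, y); split; rewrite //= /dchain /= St eqxx.
rewrite dchain_rcons2 => /and4P[/[dup] dch /IH[l' [e [sl' dl' ei ye]]] /= ii' yy' /eqP by_].
have by' : bumped S i' = Some y' by case/andP: dch => _; rewrite all_rcons => /andP[/eqP].
have [_ _ [x [Si' xy' xmin]]] := bumpedP Sinj by'.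
have [yr [t ti St] _] := bumpedP Sinj by_.
case: (ltnP i' t) => it.
  exists (rcons l' e), (t, y); split; rewrite ?size_rcons ?sl' //=.
  rewrite dchain_rcons2 dl' /= (ltn_trans ei it) (leq_trans yy' ye) /=.
  exact/eqP.
have yx : (y <= x)%N.
  move: it; rewrite leq_eqVlt => /predU1P[tE|ti'].
    by move: St; rewrite tE Si' => -[->].
  rewrite leqNgt; apply/negP => xy.
  have yr' : y \in first_row S i'.
    apply/first_row_mem => //; split; first by exists t.
    have [_ nb] := (first_row_mem i y Sinj).1 yr.
    by case=> t' t'i' bt'; apply: nb; exists t' => //; apply: ltn_trans ii'.
  by have := xmin y yr' xy; rewrite leqNgt yy'.
exists (rcons l' e), (i', x); split; rewrite ?size_rcons ?sl' //=.
rewrite dchain_rcons2 dl' ei /= (leq_trans xy' ye) /=.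
exact/eqP.
Qed.

(** The lifted chain ends before time [i] and not below the last bumped value [y]; the value
    inserted at time [i] is smaller than [y], hence extends it by one. *)
Lemma dchain_bumped S l : stream_inj S -> dchain (bumped S) l -> l != [::] ->
  exists2 l', dchain S l' & size l' = (size l).+1.
Proof.
move=> Sinj; case/lastP: l => // l [i y] dl _.
have [l' [e [sl' dl' ei ye]]] := dchain_bumped_lift Sinj dl.
have biy : bumped S i = Some y by case/andP: dl => _; rewrite all_rcons => /andP[/eqP].
have [_ _ [x [Si xy _]]] := bumpedP Sinj biy.
exists (rcons (rcons l' e) (i, x)); last by rewrite !size_rcons sl'.
by rewrite dchain_rcons2 dl' ei /= (leq_trans xy ye) /=; apply/eqP.
Qed.

Lemma iter_bumped_inj S j : stream_inj S -> stream_inj (iter j bumped S).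
Proof. by move=> Sinj; elim: j => // j IH; apply: bumped_inj. Qed.

Lemma dchain_iter_bumped S j l : stream_inj S -> dchain (iter j bumped S) l ->
  l != [::] -> exists2 l', dchain S l' & size l' = (j + size l)%N.
Proof.
move=> Sinj; elim: j l => [|j IH] l; first by exists l.
rewrite iterS => dl l0.
have [l1 dl1 sl1] := dchain_bumped (@iter_bumped_inj S j Sinj) dl l0.
have l10 : l1 != [::] by rewrite -size_eq0 sl1.
by have [l2 ? sl2] := IH l1 dl1 l10; exists l2; rewrite // sl2 sl1 addSnnS.
Qed.

(** If [x < x'], then [x'] lies in [row], so [x] bumps some value at most [x'], whereas [x'] can
    only bump a value above itself. Hence [x = x'], and the row comes back by removing [x] and
    restoring the bumped value. *)
Lemma insert_inj row row' x x' : x \notin row -> x' \notin row' ->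
  bump_val row x = bump_val row' x' -> insert row x = insert row' x' ->
  x = x' /\ row = row'.
Proof.
have aux r r' z z' : bump_val r z = bump_val r' z' -> insert r z = insert r' z' ->
    ~ (z < z')%N.
  move=> bE iE zz'.
  have : z' \in insert r z by rewrite iE /insert setU11.
  rewrite /insert in_setU1; case: eqP => [zE|_ /=]; first by rewrite zE ltnn in zz'.
  case: bump_valP bE => [y yr zy ymin|zmax].
    case: bump_valP => // y' _ z'y' _ [yE]; rewrite in_setD1 => /andP[_ z'r].
    by have := ymin z' z'r zz'; rewrite yE leqNgt z'y'.
  by move=> _ /zmax; rewrite leqNgt zz'.
move=> xr xr' bE iE.
have xE : x = x'.
  apply/val_inj; case: (ltngtP x x') => // lt.
    by case: (aux _ _ _ _ bE iE).
  by case: (aux _ _ _ _ (esym bE) (esym iE)).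
split=> //; rewrite -{}xE in xr' bE iE.
move: iE; rewrite /insert -bE; case: (bump_valP row x) bE => [y yr xy ymin|xmax].
  case: bump_valP => // y' yr' xy' _ [yE]; rewrite -{}yE in yr' * => iE.
  apply/setP => z; have /setP/(_ z) := iE; rewrite !inE.
  case: (z =P x) => [->|_]; first by rewrite (negPf xr) (negPf xr').
  by case: (z =P y) => [->|//]; rewrite yr yr'.
move=> _ iE; apply/setP => z; have /setP/(_ z) := iE; rewrite !inE.
by case: (z =P x) => [->|//]; rewrite (negPf xr) (negPf xr').
Qed.

(** Insertions are undone one at a time from the final row; the second hypothesis tells at which
    times something was inserted. *)
Lemma bumped_recover S S' (n : nat) : stream_inj S -> stream_inj S' ->
  (forall t, (t < n)%N -> isSome (S t) = isSome (S' t)) ->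
  (forall t, (t < n)%N -> bumped S t = bumped S' t) ->
  first_row S n = first_row S' n -> forall t, (t < n)%N -> S t = S' t.
Proof.
move=> Sinj Sinj'; elim: n => // n IH suppE bE rowE.
have new F x : stream_inj F -> F n = Some x -> x \notin first_row F n.
  move=> Finj Fn; apply/negP => /(first_row_mem _ _ Finj)[[t tn Ft] _].
  by rewrite (Finj _ _ _ Ft Fn) ltnn in tn.
have [SE rE] : S n = S' n /\ first_row S n = first_row S' n.
  have := suppE n (ltnSn n); have := bE n (ltnSn n); move: rowE; rewrite /= /bumped.
  have := new S; have := new S'; case: (S n) (S' n) => [x|] [x'|] // nS' nS iE bvE _.
  by have [-> ->] := insert_inj (nS x Sinj erefl) (nS' x' Sinj' erefl) bvE iE.
move=> t; rewrite ltnS leq_eqVlt => /predU1P[-> //|tn].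
by apply: IH => // i it; [apply: suppE | apply: bE]; apply: ltnW.
Qed.

Definition stream_ran S (n : nat) : {set 'I_m} :=
  [set y | [exists t : 'I_n, S t == Some y]].

Lemma stream_ranP S n y : reflect (past S n y) (y \in stream_ran S n).
Proof.
rewrite inE; apply: (iffP existsP) => [[t /eqP St]|[t tn St]]; first by exists t.
by exists (Ordinal tn); rewrite /= St.
Qed.

Lemma first_row_ran S n : stream_inj S ->
  first_row S n = stream_ran S n :\: stream_ran (bumped S) n.
Proof.
move=> Sinj; apply/setP => y; rewrite in_setD; apply/idP/andP => [|[yb yS]].
  by move=> /(first_row_mem _ _ Sinj)[yS yb]; split; [apply/stream_ranP | apply/stream_ranP].
by apply/first_row_mem => //; split; [apply/stream_ranP | apply/stream_ranP].
Qed.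

Lemma stream_ran_bumped S n : stream_inj S ->
  stream_ran (bumped S) n \subset stream_ran S n.
Proof.
move=> Sinj; apply/subsetP => y /stream_ranP[t tn /(bumpedP Sinj)[_ [t' t't St'] _]].
by apply/stream_ranP; exists t' => //; apply: ltn_trans tn.
Qed.

(** Insertion replaces an entry by a smaller one or adds one, so no count of entries below a bound
    drops. The entries below [x] all survive, since [x] bumps only a larger value, and [x] joins
    them. *)
Lemma card_first_row_below S t x (v : nat) : S t = Some x -> x \notin first_row S t ->
  (#|[set z in first_row S t | (z < v)%N]| <= #|[set z in first_row S t.+1 | (z < v)%N]|)%N
  /\ ((x < v)%N -> (#|[set z in first_row S t | (z < x)%N]| <
        #|[set z in first_row S t.+1 | (z < v)%N]|)%N).
Proof.
move=> St xnew; rewrite /= St /insert.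
split=> [|xv].
  case: bump_valP => [y yr xy ymin|xmax]; last first.
    by apply: subset_leq_card; apply/subsetP => z; rewrite !inE => /andP[-> ->]; rewrite orbT.
  case: (ltnP y v) => yv.
    rewrite (cardsD1 y) (cardsD1 x [set z in _ | _]) !inE yr yv eqxx (ltn_trans xy yv) /= ltnS.
    apply: subset_leq_card; apply/subsetP => z; rewrite !inE => /and3P[-> zr ->].
    by rewrite zr orbT /= !andbT; apply/eqP => zx; rewrite zx (negPf xnew) in zr.
  apply: subset_leq_card; apply/subsetP => z; rewrite !inE => /andP[-> zv].
  rewrite zv !andbT; apply/orP; right; apply/eqP => zy.
  by rewrite zy ltnNge yv in zv.
rewrite [X in (_ < X)%N](cardsD1 x) !inE eqxx xv /= ltnS.
apply: subset_leq_card; apply/subsetP => z; rewrite !inE => /andP[zr zx].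
rewrite (ltn_trans zx xv) andbT; apply/andP; split.
  by apply: contraTneq zx => ->; rewrite ltnn.
case: bump_valP => [y yr xy ymin|xmax]; rewrite ?inE zr ?orbT // andbT.
by apply/orP; right; apply: contraTneq zx => ->; rewrite -leqNgt ltnW.
Qed.

End Bumping.

(** A predicate closed downwards holds on an initial segment, so the number of its true values
    encodes all of them. This packs the e later rows into a single letter. *)
Lemma monotone_pred_sum (P : nat -> bool) e j : (forall i, P i.+1 -> P i) ->
  (j < e)%N -> (j < \sum_(i < e) P i)%N = P j.
Proof.
move=> Pdec; have Pdec' a b : (a <= b)%N -> P b -> P a.
  by move=> /subnK <-; elim: (b - a)%N => // c IH; rewrite addSn => /Pdec.
move=> je; case Pj: (P j).
  rewrite -(big_mkord xpredT (fun i => nat_of_bool (P i))) (@big_cat_nat _ _ _ j.+1) //=.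
  apply: leq_trans (leq_addr _ _).
  rewrite (@eq_big_nat _ _ _ _ _ _ (fun=> 1%N)) => [|i /andP[_ ij]]; last first.
    by rewrite (Pdec' i j ij Pj).
  by rewrite sum_nat_const_nat subn0 muln1.
rewrite ltnNge; apply/negbF.
rewrite -(big_mkord xpredT (fun i => nat_of_bool (P i))) (@big_cat_nat _ _ _ j) ?(ltnW je) //=.
rewrite [X in (_ + X)%N]big_nat [X in (_ + X)%N]big1 ?addn0 => [|i /andP[ji _]]; last first.
  by apply/eqP; rewrite eqb0; apply: contraFN Pj; apply: Pdec'.
apply: leq_trans (_ : (\sum_(0 <= i < j) 1 <= _)%N).
  by apply: leq_sum => i _; case: (P i).
by rewrite sum_nat_const_nat subn0 muln1.
Qed.

(** * Encoding avoiders by pairs of words *)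

Section Coding.
Import mathcomp.boot.fintype mathcomp.boot.finset.

Lemma decreasing_seq_contains_pattern n k (s : 'S_n) (l : seq 'I_n) :
  sorted (fun a b : 'I_n => (a < b)%N && (s b < s a)%N) l -> (k < size l)%N ->
  contains_pattern s (decreasing_perm k.+1).
Proof.
move=> sl kl.
have l0 : (0 < size l)%N by apply: leq_trans kl.
have x0 : 'I_n by case: l l0 {sl kl}.
have tr : transitive (fun a b : 'I_n => (a < b)%N && (s b < s a)%N).
  move=> b a c /andP[ab sba] /andP[bc scb].
  by rewrite (ltn_trans ab bc) (ltn_trans scb sba).
have nthl (i j : 'I_k.+1) : (i < j)%N ->
    (nth x0 l i < nth x0 l j)%N && (s (nth x0 l j) < s (nth x0 l i))%N.
  move=> ij; apply: (sorted_ltn_nth tr x0 sl) => //; rewrite inE.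
    exact: leq_trans (ltn_ord i) kl.
  exact: leq_trans (ltn_ord j) kl.
apply/existsP; exists [ffun i : 'I_k.+1 => nth x0 l i]; apply/andP; split.
  apply/forallP => i; apply/forallP => j; apply/implyP => ij; rewrite !ffunE.
  by case/andP: (nthl i j ij).
apply/forallP => i; apply/forallP => j; rewrite !ffunE !permE /=.
case: (ltngtP i j) => [ij|ji|/val_inj->].
- have /andP[_ lt] := nthl i j ij; apply/eqP.
  rewrite [LHS]ltnNge (ltnW lt) /=; apply/esym/negbTE; rewrite -leqNgt.
  exact/leq_sub2l/ltnW.
- have /andP[_ ->] := nthl j i ji; apply/eqP/esym.
  by apply: ltn_sub2l => //; apply: leq_ltn_trans (ltn_ord i).
- by rewrite !ltnn.
Qed.

Variables (n : nat).
Implicit Type s : 'S_n.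

Definition perm_stream s (t : nat) : option 'I_n := omap s (insub t).

Lemma perm_streamE s (t : 'I_n) : perm_stream s t = Some (s t).
Proof. by rewrite /perm_stream valK. Qed.

Lemma perm_streamP s t x : perm_stream s t = Some x ->
  exists2 i : 'I_n, t = i & x = s i.
Proof. by rewrite /perm_stream; case: insubP => // i _ <- [<-]; exists i. Qed.

Lemma perm_stream_inj s : stream_inj (perm_stream s).
Proof.
move=> t t' x /perm_streamP[i -> ->] /perm_streamP[i' -> /perm_inj->].
by [].
Qed.

(** The values entering row [j] of the RSK tableau, rows being numbered from 0. *)
Definition bumped_stream s j := iter j (@bumped n) (perm_stream s).

Lemma bumped_stream_inj s j : stream_inj (bumped_stream s j).
Proof. exact/iter_bumped_inj/perm_stream_inj. Qed.

(** A single value surviving [k] rounds of bumping is a chain of length 1, which lifts to a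
    decreasing subsequence of length [k.+1] in [s]. *)
Lemma bumped_stream_avoider s k t : s \in avoiders n (decreasing_perm k.+1) ->
  bumped_stream s k t = None.
Proof.
rewrite inE => sk; case bE: (bumped_stream s k t) => [y|//].
have dl : dchain (bumped_stream s k) [:: (t, y)] by rewrite /dchain /= bE eqxx.
have [l dl' sl] := dchain_iter_bumped (@perm_stream_inj s) dl isT.
case/negP: sk; case/andP: dl' => srt /allP al.
have [t0 Et0] : exists t0 : 'I_n, True.
  case: l al sl {srt} => [|a l] al sl; first by rewrite /= addn1 in sl.
  by have /eqP/perm_streamP[i _ _] := al a (mem_head _ _); exists i.
pose f (a : nat * 'I_n) : 'I_n := odflt t0 (insub a.1).
have fP a : a \in l -> a.1 = f a /\ a.2 = s (f a).
  move=> /al /eqP /perm_streamP[i ai1 ai2]; rewrite /f ai1 valK /=.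
  by split.
apply: (@decreasing_seq_contains_pattern n k s [seq f a | a <- l]); last first.
  by rewrite size_map sl /= addn1.
rewrite sorted_map; move: srt; apply: (@sub_in_sorted _ [in l]).
  move=> a b al_ bl /andP[ab ba] /=.
  have [a1 a2] := fP a al_; have [b1 b2] := fP b bl.
  by rewrite -a1 -b1 -a2 -b2 ab ba.
exact/allP.
Qed.

Lemma increasing_first_row s (A : {set 'I_n}) : increasing_on s A ->
  (#|A| <= #|first_row (perm_stream s) n|)%N.
Proof.
move=> /forall_inP incA.
(* The induction on time needs all value bounds [v] at once: when [t] belongs to [A], the earlier
   elements of [A] have values below [s t], and the hypothesis is used with that bound. *)
suff H t v : (t <= n)%N -> (#|[set a in A | (a < t)%N & (s a < v)%N]| <=
    #|[set z in first_row (perm_stream s) t | (z < v)%N]|)%N.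
  have := H n n (leqnn n); rewrite (_ : [set a in A | _] = A); last first.
    by apply/setP => a; rewrite !inE !ltn_ord !andbT.
  rewrite (_ : [set z in first_row _ n | _] = first_row (perm_stream s) n) //.
  by apply/setP => a; rewrite !inE !ltn_ord !andbT.
elim: t v => [|t IH] v tn.
  by rewrite (_ : [set a in A | _] = set0) ?cards0 //; apply/setP => a; rewrite !inE andbF.
pose t' := Ordinal tn; have St : perm_stream s t = Some (s t') by rewrite -(perm_streamE s t').
have new : s t' \notin first_row (perm_stream s) t.
  apply/negP => /(first_row_mem _ _ (@perm_stream_inj s))[[i it Si] _].
  by rewrite (perm_stream_inj Si St) ltnn in it.
have [mono step] := card_first_row_below v St new.
case: (boolP ((t' \in A) && (s t' < v)%N)) => [/andP[tA sv]|ntA].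
  apply: leq_trans (step sv).
  rewrite (cardsD1 t') !inE tA sv ltnSn /= add1n ltnS.
  apply: leq_trans (IH (s t') (ltnW tn)); apply: subset_leq_card.
  apply/subsetP => a; rewrite !inE ltnS => /and4P[at' aA alet _].
  have alt : (a < t)%N by rewrite ltn_neqAle alet andbT -[t]/(val t') val_eqE.
  rewrite aA alt /=; have /forall_inP/(_ _ tA)/implyP := incA a aA; exact.
apply: leq_trans mono; apply: leq_trans (IH v (ltnW tn)); apply: subset_leq_card.
apply/subsetP => a; rewrite !inE ltnS => /and3P[aA alet av].
rewrite aA av andbT /= ltn_neqAle alet andbT.
by apply: contraNneq ntA => at'; rewrite (_ : t' = a) ?aA //; apply/val_inj.
Qed.

Variable e : nat.

(** The row, capped at [e], where the insertion started at time [t] ends, as in the recording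
    tableau of RSK. Likewise [value_word] gives the row where a value finally rests, as in the
    insertion tableau. *)
Definition position_word s : {ffun 'I_n -> 'I_e.+1} :=
  [ffun t : 'I_n => inord (\sum_(j < e) isSome (bumped_stream s j.+1 t))].

Definition value_word s : {ffun 'I_n -> 'I_e.+1} :=
  [ffun y => inord (\sum_(j < e) (y \in stream_ran (bumped_stream s j.+1) n))].

Lemma bool_sum_lt (P : nat -> bool) : (\sum_(j < e) P j < e.+1)%N.
Proof.
rewrite ltnS; apply: leq_trans (_ : (\sum_(j < e) 1 <= _)%N).
  by apply: leq_sum => i _; case: (P i).
by rewrite sum_nat_const card_ord muln1.
Qed.

Lemma bumped_streamS_some s j t :
  isSome (bumped_stream s j.+1 t) -> isSome (bumped_stream s j t).
Proof. by rewrite /bumped_stream iterS /bumped; case: (iter j _ _ t). Qed.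

Lemma ltn_position_word s j (t : 'I_n) : (j < e)%N ->
  (j < position_word s t)%N = isSome (bumped_stream s j.+1 t).
Proof.
move=> je; rewrite ffunE inordK ?(bool_sum_lt (fun j => isSome (bumped_stream s j.+1 t))) //.
apply: (monotone_pred_sum (P := fun j => isSome (bumped_stream s j.+1 t))) => // i.
exact: bumped_streamS_some.
Qed.

Lemma ltn_value_word s j (y : 'I_n) : (j < e)%N ->
  (j < value_word s y)%N = (y \in stream_ran (bumped_stream s j.+1) n).
Proof.
move=> je; rewrite ffunE inordK
  ?(bool_sum_lt (fun j => y \in stream_ran (bumped_stream s j.+1) n)) //.
apply: (monotone_pred_sum (P := fun j => y \in stream_ran (bumped_stream s j.+1) n)) => // i.
exact: (subsetP (stream_ran_bumped n (@bumped_stream_inj s i.+1))).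
Qed.

(** Descending induction on the row: stream [e.+1] is empty for avoiders, stream 0 is the
    permutation, and [bumped_recover] goes from stream [i.+1] to stream [i]. The position word
    supplies the times of insertion. *)
Lemma words_inj : {in avoiders n (decreasing_perm e.+2) &,
  injective (fun s => (position_word s, value_word s))}.
Proof.
move=> s s' sA sA' E.
have pE : position_word s = position_word s' := congr1 fst E.
have vE : value_word s = value_word s' := congr1 snd E.
suff H j : (j <= e.+1)%N -> forall t, (t < n)%N ->
    bumped_stream s (e.+1 - j) t = bumped_stream s' (e.+1 - j) t.
  apply/permP => i; have := H e.+1 (leqnn _) i (ltn_ord i).
  by rewrite subnn /bumped_stream /= !perm_streamE => -[].
elim: j => [_ t tn|j IH je].
  by rewrite subn0 !bumped_stream_avoider.
have := IH (ltnW je); rewrite subSS (subSn (je : (j <= e)%N)).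
move: (e - j)%N (leq_subr j e) => i ie {}IH.
apply: bumped_recover; try exact: bumped_stream_inj.
- move=> t tn; case: i ie {IH} => [_|i ie].
    by rewrite /bumped_stream /= -[t]/(nat_of_ord (Ordinal tn)) !perm_streamE.
  rewrite -[t]/(nat_of_ord (Ordinal tn)) -(ltn_position_word s _ ie).
  by rewrite -(ltn_position_word s' _ ie) pE.
- exact: IH.
(* The final row [i] is the range of stream [i] minus that of stream [i.+1]. The latter is known by
   induction; the former is read off the value word, or is everything when [i] is 0. *)
rewrite !first_row_ran; try exact: bumped_stream_inj.
congr (_ :\: _); last first.
  apply/setP => y; rewrite !inE; apply: eq_existsb => t.
  by have := IH t (ltn_ord t); rewrite /bumped_stream !iterS => ->.
case: i ie {IH} => [_|i ie]; last first.
  by apply/setP => y; rewrite -(ltn_value_word s y ie) -(ltn_value_word s' y ie) vE.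
have full r : stream_ran (bumped_stream r 0) n = setT.
  apply/setP => y; rewrite in_setT; apply/stream_ranP; exists ((r^-1)%g y); first exact: ltn_ord.
  by rewrite /bumped_stream /= perm_streamE permKV.
by rewrite !full.
Qed.

Lemma LIS_witness s : exists2 A : {set 'I_n}, increasing_on s A & #|A| = LIS s.
Proof.
rewrite /LIS; have i0 : increasing_on s set0 by apply/forall_inP => i; rewrite inE.
by case: (eq_bigmax_cond (fun A : {set 'I_n} => #|A|) (A := [pred A | increasing_on s A])) =>
  [|A Ai AE]; [apply/card_gt0P; exists set0 | exists A].
Qed.

Lemma increasing_LIS s A : increasing_on s A -> (#|A| <= LIS s)%N.
Proof. by move=> Ai; apply: (leq_bigmax_cond (F := fun A : {set 'I_n} => #|A|)). Qed.

Lemma LIS_le s : (LIS s <= n)%N.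
Proof. by apply/bigmax_leqP => A _; rewrite -[leqRHS]card_ord max_card. Qed.

Definition zeros (w : {ffun 'I_n -> 'I_e.+1}) := #|[set t | w t == ord0]|.

Lemma LIS_zeros_value s : (LIS s <= zeros (value_word s))%N.
Proof.
have [A Ai <-] := LIS_witness s.
apply: leq_trans (increasing_first_row Ai) _; apply: subset_leq_card.
apply/subsetP => y; rewrite (first_row_ran _ (@perm_stream_inj s)) in_setD => /andP[yb _].
rewrite inE -val_eqE /= -leqn0 leqNgt; apply/negP; case: (posnP e) => [e0|e0].
  by move: (value_word s y) => z; have := ltn_ord z; rewrite {2}e0 ltnS leqn0 => /eqP->.
by rewrite ltn_value_word // (negPf yb).
Qed.

(** Distinct bumping times bump distinct values, so the times without a bump are at least as many as
    the values never bumped, which make up the final first row. *)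
Lemma LIS_zeros_position s : (LIS s <= zeros (position_word s))%N.
Proof.
have [A Ai <-] := LIS_witness s.
apply: leq_trans (increasing_first_row Ai) _.
rewrite (first_row_ran _ (@perm_stream_inj s)).
pose D := [set t : 'I_n | isSome (bumped_stream s 1 t)].
have DE : (#|D| <= #|stream_ran (bumped_stream s 1) n|)%N.
  pose f (t : 'I_n) := odflt t (bumped_stream s 1 t).
  have fP t : t \in D -> bumped_stream s 1 t = Some (f t).
    by rewrite inE /f; case: (bumped_stream s 1 t).
  rewrite -(@card_in_imset _ _ f D) => [|t t' tD t'D ff].
    apply: subset_leq_card; apply/subsetP => _ /imsetP[t tD ->].
    by apply/stream_ranP; exists t => //; apply: fP.
  by apply/val_inj/(bumped_stream_inj (fP t tD)); rewrite ff; apply: fP.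
have : (#|~: stream_ran (bumped_stream s 1) n| <= #|~: D|)%N.
  by rewrite -(leq_add2l #|D|) cardsC -(cardsC (stream_ran (bumped_stream s 1) n)) leq_add2r.
move=> H; apply: leq_trans (leq_trans _ H) _; apply: subset_leq_card; apply/subsetP => y.
  by rewrite !inE => /andP[].
rewrite !inE => yb.
rewrite -val_eqE /= -leqn0 leqNgt; apply/negP; case: (posnP e) => [e0|e0].
  by move: (position_word s y) => z; have := ltn_ord z; rewrite {2}e0 ltnS leqn0 => /eqP->.
by rewrite ltn_position_word // (negPf yb).
Qed.

Lemma card_avoiders_LIS (P : pred nat) : (forall a b, (a <= b)%N -> P a -> P b) ->
  (#|[set s in avoiders n (decreasing_perm e.+2) | P (LIS s)]| <=
     #|[set w : {ffun 'I_n -> 'I_e.+1} | P (zeros w)]| ^ 2)%N.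
Proof.
move=> Pmono; rewrite -mulnn -cardsX.
rewrite -(@card_in_imset _ _ (fun s => (position_word s, value_word s))).
  apply: subset_leq_card; apply/subsetP => _ /imsetP[s + ->].
  rewrite inE => /andP[_ Ps]; rewrite !inE /=.
  by rewrite (Pmono _ _ (LIS_zeros_position s)) // (Pmono _ _ (LIS_zeros_value s)).
by move=> s s'; rewrite !inE => /andP[sA _] /andP[s'A _]; apply: words_inj; rewrite inE.
Qed.

End Coding.

(** * The Erdos-Szekeres lower bound for the longest increasing subsequence *)

Section ErdosSzekeres.
Import mathcomp.boot.fintype mathcomp.boot.finset.

Lemma sorted_enum_ord n (A : {set 'I_n}) :
  sorted (fun a b : 'I_n => (a < b)%N) (enum A).
Proof.
rewrite {1}/enum_mem -enumT; apply: sorted_filter; first by move=> b a c; apply: ltn_trans.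
by have := iota_ltn_sorted 0 n; rewrite -val_enum_ord sorted_map.
Qed.

(** The Erdos-Szekeres label: the longest length of an increasing subsequence ending at position
    [i]. *)
Definition level n (s : 'S_n) (i : 'I_n) : nat :=
  \max_(A : {set 'I_n} | [&& increasing_on s A, i \in A & [forall j in A, (j <= i)%N]]) #|A|.

Lemma level_gt0 n (s : 'S_n) i : (0 < level s i)%N.
Proof.
apply: leq_trans (leq_bigmax_cond (F := fun A : {set 'I_n} => #|A|) [set i] _).
  by rewrite cards1.
apply/and3P; split; rewrite ?set11 //; last by apply/forall_inP => j /set1P->.
apply/forall_inP => j /set1P->; apply/forall_inP => l /set1P->.
by rewrite ltnn.
Qed.

Lemma level_LIS n (s : 'S_n) i : (level s i <= LIS s)%N.
Proof. by apply/bigmax_leqP => A /and3P[/increasing_LIS]. Qed.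

Lemma level_lt n (s : 'S_n) (i j : 'I_n) : (i < j)%N -> (s i < s j)%N ->
  (level s i < level s j)%N.
Proof.
move=> ij sij.
have ne : (0 < #|[pred A : {set 'I_n} |
    [&& increasing_on s A, i \in A & [forall j in A, (j <= i)%N]]]|)%N.
  apply/card_gt0P; exists [set i]; apply/and3P; split; rewrite ?set11 //;
    last by apply/forall_inP => l /set1P->.
  apply/forall_inP => a /set1P->; apply/forall_inP => l /set1P->.
  by rewrite ltnn.
have [A /and3P[/forall_inP Ai iA /forall_inP Ami] AE] :=
  eq_bigmax_cond (fun A : {set 'I_n} => #|A|) ne.
have jA : j \notin A by apply/negP => /Ami; rewrite leqNgt ij.
rewrite /level AE -(@addn1 #|A|) addnC -[1%N]/(nat_of_bool true) -jA -cardsU1.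
apply: (leq_bigmax_cond (F := fun A : {set 'I_n} => #|A|)).
apply/and3P; split; rewrite ?setU11 //; last first.
  by apply/forall_inP => a /setU1P[->//|/Ami ai]; apply: leq_trans (ltnW ij).
apply/forall_inP => a /setU1P[->|aA]; apply/forall_inP => b /setU1P[->|bA].
- by rewrite ltnn.
- by apply/implyP => jb; have := leq_trans jb (Ami b bA); rewrite ltnNge ltnW.
- apply/implyP => _; have := Ami a aA; rewrite leq_eqVlt => /predU1P[ai|ai].
    by rewrite (val_inj ai).
  by apply: ltn_trans sij; have /forall_inP/(_ i iA)/implyP := Ai a aA; apply.
- by have /forall_inP/(_ b bA) := Ai a aA.
Qed.

(** Positions of equal level carry a decreasing subsequence, so each level has at most [k]
    positions. Levels start at 1, hence the predecessor in the index [f]. *)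
Lemma avoider_LIS_ge n k (s : 'S_n) : s \in avoiders n (decreasing_perm k.+1) ->
  (n <= LIS s * k)%N.
Proof.
rewrite inE => sav.
have lt i : ((level s i).-1 < LIS s)%N by rewrite prednK ?level_gt0 ?level_LIS.
pose f i := Ordinal (lt i).
rewrite -[leqLHS]card_ord -sum1_card (partition_big f xpredT) //=.
rewrite -[X in (X * _)%N]card_ord -sum_nat_const; apply: leq_sum => l _.
rewrite sum1_card leqNgt; apply: contra sav => kl.
apply: (@decreasing_seq_contains_pattern n k s (enum [set i | f i == l])); last first.
  by rewrite -cardE cardsE.
apply: (sub_in_sorted (P := [in [set i | f i == l]]) _ _ (sorted_enum_ord _)); last first.
  by apply/allP => i; rewrite mem_enum.
move=> i j; rewrite !inE => /eqP fi /eqP fj ij; rewrite ij /= ltnNge.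
apply/negP; rewrite leq_eqVlt => /predU1P[/val_inj/perm_inj ijE|sij].
  by rewrite ijE ltnn in ij.
have := level_lt ij sij; have /(congr1 val) /= := fi; rewrite -fj /= => E.
by rewrite -(prednK (level_gt0 s i)) -(prednK (level_gt0 s j)) E ltnn.
Qed.

End ErdosSzekeres.

(** * Permutations from pairs of balanced words *)

Section Words.
Import mathcomp.boot.fintype mathcomp.boot.finset.
Variables (n d : nat).
Implicit Types (u v w : {ffun 'I_n -> 'I_d}) (x y : 'I_n).

Definition word_rank u x := #|[set x' : 'I_n | (x' < x)%N & u x' == u x]|.
Definition color_size u i := #|[set x | u x == i]|.

Lemma word_rank_lt u x y : (x < y)%N -> u x = u y -> (word_rank u x < word_rank u y)%N.
Proof.
move=> xy uE; apply: proper_card; apply/properP; split.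
  apply/subsetP => z; rewrite !inE uE => /andP[zx ->]; rewrite andbT.
  exact: ltn_trans xy.
by exists x; rewrite !inE ?xy ?uE ?eqxx // ltnn.
Qed.

Lemma word_rank_inj u x y : u x = u y -> word_rank u x = word_rank u y -> x = y.
Proof.
move=> uE rE; apply/val_inj; case: (ltngtP x y) => // lt.
  by have := word_rank_lt lt uE; rewrite rE ltnn.
by have := word_rank_lt lt (esym uE); rewrite rE ltnn.
Qed.

Lemma word_rank_lt_size u x : (word_rank u x < color_size u (u x))%N.
Proof.
apply: proper_card; apply/properP; split.
  by apply/subsetP => z; rewrite !inE => /andP[].
by exists x; rewrite !inE ?eqxx // ltnn.
Qed.

Lemma word_rank_surj u i r : (r < color_size u i)%N ->
  exists2 x, u x = i & word_rank u x = r.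
Proof.
move=> ri; pose A := enum [set x | u x == i].
have AP x : x \in A -> u x = i by rewrite mem_enum inE => /eqP.
have sA : size A = color_size u i by rewrite -cardE.
have [|||_ E] := @uniq_min_size _ [seq word_rank u x | x <- A] (iota 0 (color_size u i)).
- rewrite map_inj_in_uniq ?enum_uniq // => x y /AP ux /AP uy.
  by apply: word_rank_inj; rewrite ux uy.
- by move=> _ /mapP[x /AP <- ->]; rewrite mem_iota word_rank_lt_size.
- by rewrite size_map size_iota sA.
have : r \in iota 0 (color_size u i) by rewrite mem_iota.
by rewrite -E => /mapP[x /AP ux ->]; exists x.
Qed.

Definition is_matching u v (s : 'S_n) :=
  [forall x, (v (s x) == u x) && (word_rank v (s x) == word_rank u x)].

(** Sends the r-th occurrence of a letter in [u] to its r-th occurrence in [v]. The default identity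
    is never taken when the contents agree, by [matchingP]. *)
Definition matching u v : 'S_n := odflt 1%g [pick s | is_matching u v s].

Lemma matchingP u v x : (forall i, color_size u i = color_size v i) ->
  v (matching u v x) = u x /\ word_rank v (matching u v x) = word_rank u x.
Proof.
move=> sE; suff /forallP/(_ x)/andP[/eqP-> /eqP->] : is_matching u v (matching u v) by [].
rewrite /matching; case: pickP => //= nos.
pose f x := odflt x [pick y | (v y == u x) && (word_rank v y == word_rank u x)].
have fP z : v (f z) = u z /\ word_rank v (f z) = word_rank u z.
  rewrite /f; case: pickP => /= [y /andP[/eqP-> /eqP->] //|no].
  have [|y vy ry] := @word_rank_surj v (u z) (word_rank u z).
    by rewrite -sE word_rank_lt_size.
  by have := no y; rewrite vy ry !eqxx.
have finj : injective f.
  move=> y z fE; have [vy ry] := fP y; have [vz rz] := fP z.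
  by apply: (@word_rank_inj u); rewrite -?vy -?vz -?ry -?rz fE.
have := nos (perm finj); suff -> : is_matching u v (perm finj) by [].
by apply/forallP => z; rewrite permE; have [-> ->] := fP z; rewrite !eqxx.
Qed.

(** The value word will be a reversed balanced word: reversal turns the delay of letter [i] by [i]
    blocks into an advance. *)
Definition rev_word u : {ffun 'I_n -> 'I_d} := [ffun x => u (rev_ord x)].

Lemma rev_word_inj : injective rev_word.
Proof.
move=> u v /ffunP E; apply/ffunP => x.
by have := E (rev_ord x); rewrite !ffunE rev_ordK.
Qed.

Lemma color_size_rev u i : color_size (rev_word u) i = color_size u i.
Proof.
rewrite /color_size -(card_imset _ (@rev_ord_inj n)); congr #|pred_of_set _|.
apply/setP => x; apply/imsetP/idP => [[y + ->]|]; first by rewrite !inE ffunE.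
by rewrite inE => ux; exists (rev_ord x); rewrite ?rev_ordK // !inE ffunE rev_ordK.
Qed.

Lemma word_rank_rev u y :
  (word_rank (rev_word u) y + (word_rank u (rev_ord y)).+1)%N = color_size u (u (rev_ord y)).
Proof.
have -> : word_rank (rev_word u) y =
    #|[set x' : 'I_n | (rev_ord y < x')%N & u x' == u (rev_ord y)]|.
  rewrite /word_rank -(card_imset _ (@rev_ord_inj n)); congr #|pred_of_set _|.
  apply/setP => x; apply/imsetP/idP => [[z + ->]|].
    rewrite !inE !ffunE => /andP[zy ->]; rewrite andbT /=.
    by have := ltn_ord y; have := ltn_ord z; lia.
  rewrite inE => /andP[yx ux]; exists (rev_ord x);
    rewrite ?rev_ordK // !inE !ffunE rev_ordK ux andbT.
  by move: yx; rewrite /=; have := ltn_ord y; have := ltn_ord x; lia.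
set z := rev_ord y; rewrite addnS -[_.+1]addn1.
have -> : 1%N = #|[set z]| by rewrite cards1.
rewrite /word_rank -cardsUI (_ : _ :&: _ = set0) ?cards0 ?addn0; last first.
  by apply/setP => x; rewrite !inE; case: (ltngtP x z); rewrite ?andbF.
rewrite -cardsUI (_ : _ :&: [set z] = set0) ?cards0 ?addn0; last first.
  by apply/setP => x; rewrite !inE; case: (x =P z) => [->|]; rewrite ?ltnn ?andbF.
congr #|pred_of_set _|; apply/setP => x; rewrite !inE.
case: (x =P z) => [->|/eqP xz]; first by rewrite eqxx orbT.
by rewrite orbF -andb_orl orbC -neq_ltn val_eqE xz.
Qed.

Variables (T : nat) (g : 'I_d -> nat).
Hypothesis g_gt0 : forall i, (0 < g i)%N.

(* Letter i of group t (among groups of g i consecutive occurrences) sits in block t + i. *)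
Definition block u x := (u x + word_rank u x %/ g (u x))%N.

(** The blocks are not stored; monotonicity of [block] says that each block is contiguous and that
    blocks come in order. *)
Definition balanced : {set {ffun 'I_n -> 'I_d}} :=
  [set u : {ffun 'I_n -> 'I_d} | [forall i, color_size u i == (T * g i)%N] &&
    [forall x : 'I_n, forall y : 'I_n, (x < y)%N ==> (block u x <= block u y)%N]].

Lemma balancedP u : u \in balanced ->
  (forall i, color_size u i = (T * g i)%N) /\
  (forall x y, (x < y)%N -> (block u x <= block u y)%N).
Proof.
rewrite inE => /andP[/forallP cu /forallP bu]; split=> [i|x y xy].
  exact/eqP.
by have /forallP/(_ y)/implyP := bu x; apply.
Qed.

Lemma divn_rev b a r : (0 < b)%N -> (r < a * b)%N ->
  ((a * b - r.+1) %/ b + r %/ b)%N = a.-1.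
Proof.
move=> b0 rab; have ra : (r %/ b < a)%N by rewrite ltn_divLR.
have -> : (a * b - r.+1 = (a.-1 - r %/ b) * b + (b.-1 - r %% b))%N.
  have rb := ltn_pmod r b0; have := divn_eq r b; move: (r %/ b)%N (r %% b)%N ra rb => q m qa mb rE.
  have -> : (a = (a.-1 - q) + q + 1)%N by lia.
  rewrite !mulnDl mul1n; nia.
rewrite divnMDl // (@divn_small (b.-1 - r %% b)%N) ?addn0.
  by rewrite subnK //; move: ra; move: (r %/ b)%N => q; lia.
by move: (r %% b)%N => q; lia.
Qed.

Section Pair.
Variables (u w : {ffun 'I_n -> 'I_d}).
Hypotheses (ub : u \in balanced) (wb : w \in balanced).

Let s := matching u (rev_word w).

Let sizes i : color_size u i = color_size (rev_word w) i.
Proof. by rewrite color_size_rev (balancedP ub).1 (balancedP wb).1. Qed.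

Let group x := (word_rank u x %/ g (u x))%N.

Lemma matching_color x : rev_word w (s x) = u x.
Proof. exact: (matchingP x sizes).1. Qed.

Lemma group_lt x : (group x < T)%N.
Proof.
rewrite /group ltn_divLR // -(balancedP ub).1; exact: word_rank_lt_size.
Qed.

(** The image keeps its letter, while reversal counts its group from the other end, giving group
    [T.-1 - group x]. *)
Lemma block_matching x : (block w (rev_ord (s x)) + group x)%N = (u x + T.-1)%N.
Proof.
have [cx rx] := matchingP x sizes.
have wE : w (rev_ord (s x)) = u x by rewrite -matching_color ffunE.
have := word_rank_rev w (s x); rewrite rx wE (balancedP wb).1 => rE.
have -> : block w (rev_ord (s x)) = (u x + (T * g (u x) - (word_rank u x).+1) %/ g (u x))%N.
  by rewrite /block wE; congr (_ + _ %/ _)%N; rewrite -rE; lia.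
rewrite -addnA divn_rev // -(balancedP ub).1; exact: word_rank_lt_size.
Qed.

Lemma matching_increasing x y : (x < y)%N -> u x = u y -> (s x < s y)%N.
Proof.
move=> xy uE; rewrite ltnNge leq_eqVlt; apply/negP => /predU1P[/val_inj/perm_inj yx|yx].
  by rewrite yx ltnn in xy.
have := @word_rank_lt (rev_word w) _ _ yx; rewrite !matching_color uE => /(_ erefl).
rewrite (matchingP x sizes).2 (matchingP y sizes).2 ltnNge ltnW //.
exact: word_rank_lt.
Qed.

Lemma rev_ord_lt (x y : 'I_n) : (rev_ord x < rev_ord y)%N = (y < x)%N.
Proof. by rewrite /=; have := ltn_ord x; have := ltn_ord y; lia. Qed.

(** The order of positions compares [u + group] at [x] and [y], the reversed order of values
    compares [u - group]; adding the two removes the groups. Equality of letters is excluded because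
    equal letters are never inverted. *)
Lemma matching_inversion x y : (x < y)%N -> (s y < s x)%N -> (u x < u y)%N.
Proof.
move=> xy yx; have bxy := (balancedP ub).2 x y xy.
have := (balancedP wb).2 (rev_ord (s x)) (rev_ord (s y)); rewrite rev_ord_lt => /(_ yx).
have := block_matching x; have := block_matching y; move: bxy; rewrite {1 2}/block -!/(group _).
have : u x != u y by apply/eqP => uE; have := matching_increasing xy uE; rewrite ltnNge ltnW.
rewrite -val_eqE /=; lia.
Qed.

Lemma matching_predecessor y : (0 < u y)%N ->
  exists x, [/\ (x < y)%N, (s y < s x)%N & (u y = (u x).+1 :> nat)].
Proof.
move=> uy; have id_ : ((u y).-1 < d)%N by have := ltn_ord (u y); lia.
pose i : 'I_d := Ordinal id_.
(* The witness is the first occurrence of the preceding letter in the group with the same number as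
   that of [y]; it sits one block earlier both in [u] and in [w]. *)
have [|x ux rx] := @word_rank_surj u i (group y * g i)%N.
  by rewrite (balancedP ub).1 ltn_pmul2r // group_lt.
have gE : group x = group y by rewrite /group ux rx mulnK.
have uE : u y = (u x).+1 :> nat by rewrite ux /= prednK.
have bE z : block u z = (u z + group z)%N by [].
exists x; split=> //.
  rewrite ltnNge leq_eqVlt; apply/negP => /predU1P[/val_inj yx|yx].
    by move: uE; rewrite yx; lia.
  by have := (balancedP ub).2 y x yx; rewrite !bE gE; lia.
rewrite -rev_ord_lt ltnNge leq_eqVlt; apply/negP => /predU1P[/val_inj/rev_ord_inj/perm_inj yx|yx].
  by move: uE; rewrite yx; lia.
have := (balancedP wb).2 _ _ yx; have := block_matching x; have := block_matching y; lia.
Qed.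

End Pair.

(** The permutation determines the letters by induction on position: a nonzero [u x] is one more
    than the letter of some earlier larger value, where [u'] agrees, and this inversion forces [u']
    to increase too. By symmetry [u = u'], and [w] is [u] carried along the permutation. *)
Lemma matching_inj u w u' w' : u \in balanced -> w \in balanced ->
  u' \in balanced -> w' \in balanced ->
  matching u (rev_word w) = matching u' (rev_word w') -> u = u' /\ w = w'.
Proof.
move=> ub wb ub' wb' sE.
have uE : u = u'.
  apply/ffunP => x; apply/val_inj => /=.
  have [m] := ubnP x; elim: m x => // m IH x; rewrite ltnS => xm.
  apply/eqP; rewrite eqn_leq; apply/andP; split.
    case: (posnP (u x)) => [->//|/(matching_predecessor ub wb)[y [yx sxy ->]]].
    rewrite (IH y (leq_trans yx xm)); apply: (matching_inversion ub' wb' yx).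
    by rewrite -sE.
  case: (posnP (u' x)) => [->//|/(matching_predecessor ub' wb')[y [yx sxy ->]]].
  rewrite -(IH y (leq_trans yx xm)); apply: (matching_inversion ub wb yx).
  by rewrite sE.
split=> //; apply: rev_word_inj; apply/ffunP => y.
set s := matching u (rev_word w) in sE; rewrite -(permKV s y).
by rewrite matching_color // {2}sE matching_color // uE.
Qed.

End Words.

(** * Unions of increasing subsequences with one prescribed large class *)

Section Colorable.
Import mathcomp.boot.fintype mathcomp.boot.finset.
Variable e : nat.

Definition colorable n (a : nat) : {set 'S_n} :=
  [set s : 'S_n | [exists c : {ffun 'I_n -> 'I_e.+1},
    [forall i : 'I_n, forall j : 'I_n, (i < j)%N && (c i == c j) ==> (s i < s j)%N] &&
    (a <= color_size c ord0)%N]].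

Lemma colorableP n a (s : 'S_n) :
  reflect (exists2 c : {ffun 'I_n -> 'I_e.+1},
    forall i j : 'I_n, (i < j)%N -> c i = c j -> (s i < s j)%N & (a <= color_size c ord0)%N)
  (s \in colorable n a).
Proof.
rewrite inE; apply: (iffP existsP) => [[c /andP[/forallP H ca]]|[c H ca]]; exists c => //.
  by move=> i j ij cE; have /forallP/(_ j)/implyP := H i; rewrite ij cE eqxx; apply.
rewrite ca andbT; apply/forallP => i; apply/forallP => j; apply/implyP => /andP[ij /eqP cE].
exact: H.
Qed.

(** The entries of a decreasing subsequence have distinct colors, so there are at most [e.+1] of
    them; color 0 is itself an increasing subsequence. *)
Lemma colorable_avoider n a : colorable n a \subset
  [set s in avoiders n (decreasing_perm e.+2) | (a <= LIS s)%N].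
Proof.
apply/subsetP => s /colorableP[c H ca]; rewrite !inE; apply/andP; split; last first.
  apply: leq_trans ca _; apply: increasing_LIS.
  apply/forall_inP => i; rewrite inE => /eqP ci; apply/forall_inP => j; rewrite inE => /eqP cj.
  by apply/implyP => ij; apply: H; rewrite ?ci ?cj.
apply/existsP => -[f /andP[/forallP finc /forallP fpat]].
have dec (i j : 'I_e.+2) : (i < j)%N -> c (f i) != c (f j).
  move=> ij; apply/eqP => cE.
  have /forallP/(_ j)/implyP/(_ ij) fij := finc i.
  have := H _ _ fij cE; have /forallP/(_ j)/eqP -> := fpat i; rewrite !permE /=; lia.
have inj : injective (c \o f).
  move=> i j /= cE; apply/val_inj; case: (ltngtP i j) => // ij.
    by have := dec _ _ ij; rewrite cE eqxx.
  by have := dec _ _ ij; rewrite cE eqxx.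
by have := leq_card _ inj; rewrite !card_ord ltnn.
Qed.

Lemma card_colorable_matching n T (g : 'I_e.+1 -> nat) : (forall i, (0 < g i)%N) ->
  (#|balanced n T g| ^ 2 <= #|colorable n (T * g ord0)|)%N.
Proof.
move=> g0; rewrite -mulnn -cardsX.
rewrite -(@card_in_imset _ _ (fun p => matching p.1 (rev_word p.2))); last first.
  move=> [u w] [u' w'] /setXP[/= ub wb] /setXP[/= ub' wb'] E.
  by have [-> ->] := matching_inj g0 ub wb ub' wb' E.
apply: subset_leq_card; apply/subsetP => _ /imsetP[[u w] /setXP[/= ub wb] ->].
apply/colorableP; exists u; last by rewrite (balancedP ub).1.
by move=> i j ij uE; apply: (matching_increasing ub wb).
Qed.

(** A new largest value is placed at the end and given color 0. *)
Lemma card_colorableS n a : (#|colorable n a| <= #|colorable n.+1 a.+1|)%N.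
Proof.
rewrite -(@card_imset _ _ (lift_perm ord_max ord_max) (colorable n a)); last first.
  move=> s s' E; apply/permP => i; have := congr1 (fun p : 'S_n.+1 => p (lift ord_max i)) E.
  by rewrite !lift_perm_lift => /lift_inj.
apply: subset_leq_card; apply/subsetP => _ /imsetP[s /colorableP[c H ca] ->].
apply/colorableP.
exists [ffun i => if unlift ord_max i is Some j then c j else ord0].
  move=> i j; rewrite !ffunE.
  case: (unliftP ord_max i) => [i'|] ->; case: (unliftP ord_max j) => [j'|] ->.
  - rewrite !lift_perm_lift !lift_max; exact: H.
  - by move=> _ _; rewrite lift_perm_lift lift_perm_id lift_max /=.
  - by rewrite lift_max /= ltnNge ltnW.
  - by rewrite ltnn.
rewrite /color_size (cardsD1 ord_max) inE ffunE unlift_none eqxx add1n ltnS.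
apply: leq_trans ca _; rewrite /color_size -(card_imset [set x | c x == _] (@lift_inj _ ord_max)).
apply: subset_leq_card; apply/subsetP => _ /imsetP[i + ->].
by rewrite !inE ffunE liftK => ->; rewrite eq_sym neq_lift.
Qed.

Lemma card_colorableD n a r : (#|colorable n a| <= #|colorable (n + r) (a + r)|)%N.
Proof.
elim: r => [|r IH]; first by rewrite !addn0.
by rewrite !addnS; apply: leq_trans IH (card_colorableS _ _).
Qed.

End Colorable.

(** * Counting words of given content *)

Section BalancedCount.
Import mathcomp.boot.fintype mathcomp.boot.finset.
Variable d : nat.
Implicit Types (h g : 'I_d -> nat) (a b : seq 'I_d).

Lemma sum_count_mem a : (\sum_(i < d) count_mem i a)%N = size a.
Proof.
elim: a => [|x a IH]; first by rewrite big1.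
rewrite /= big_split /= IH (bigD1 x) //= eqxx big1 => [|i ix]; first by lia.
by rewrite eq_sym (negPf ix).
Qed.

Lemma size_permutations_multinomial a :
  (size (permutations a) * \prod_(i < d) (count_mem i a)`!)%N = (size a)`!.
Proof.
have [m] := ubnP (size a); elim: m a => // m IH a; rewrite ltnS => am.
case: (posnP (size a)) => [/size0nil ->|a0].
  by rewrite big1.
rewrite (perm_size (permutationsE a0)) size_allpairs_dep sumnE big_map.
rewrite big_distrl /=.
(* Sorting the arrangements by first letter, the letter [x] contributes its multiplicity times
   [(size a).-1]!, by induction on the word with one [x] removed. *)
rewrite (eq_big_seq (fun x => (size a).-1`! * count_mem x a)%N); last first.
  move=> x; rewrite mem_undup => xa.
  have sr : size (rem x a) = (size a).-1 by rewrite size_rem.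
  rewrite -sr -(IH (rem x a)); last by rewrite sr; lia.
  rewrite -mulnA; congr (_ * _)%N.
  have cx : (0 < count_mem x a)%N by rewrite -has_count has_pred1.
  have cr i : count_mem i (rem x a) = (count_mem i a - (i == x))%N.
    by rewrite count_rem xa /= eq_sym.
  rewrite (bigD1 x) // [in RHS](bigD1 x) //= cr eqxx subn1 -[X in (X`! * _)%N](prednK cx) factS.
  rewrite prednK // [RHS]mulnC -!mulnA; congr (_ * (_ * _))%N.
  by apply: eq_bigr => i /negPf ix; rewrite cr ix subn0.
rewrite -big_distrr /= (big_uniq _ (undup_uniq a)) /= -[in RHS](prednK a0) factS mulnC.
rewrite prednK //; congr (_ * _)%N; rewrite -[RHS]sum_count_mem big_mkcond /=.
apply: eq_bigr => i _; rewrite mem_undup; case: ifP => // /negbT/count_memPn ->.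
by [].
Qed.

(** One word of content [h]; its permutations are all the words of that content. *)
Definition spread h : seq 'I_d := flatten [seq nseq (h i) i | i <- enum 'I_d].

Lemma count_spread h i : count_mem i (spread h) = h i.
Proof.
rewrite /spread count_flatten -map_comp sumnE big_map big_enum /=.
rewrite (bigD1 i) //= count_nseq /= eqxx mul1n big1 ?addn0 // => j ji.
by rewrite count_nseq /= (negPf ji).
Qed.

Lemma card_ord_iota (P : pred nat) n x : (x <= n)%N ->
  #|[set y : 'I_n | (y < x)%N & P y]| = count P (iota 0 x).
Proof.
move=> xn; rewrite cardsE cardE size_filter -enumT.
rewrite -(count_map val (fun y => (y < x)%N && P y)) val_enum_ord.
rewrite -(subnKC xn) iotaD count_cat add0n.
rewrite [X in (_ + X)%N](_ : _ = 0)%N ?addn0.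
  by apply: eq_in_count => y; rewrite mem_iota /= => ->.
apply/eqP; rewrite -leqn0 leqNgt -has_count; apply/hasPn => y.
by rewrite mem_iota => /andP[xy _]; rewrite ltnNge xy.
Qed.

Lemma take_nth_iota x0 a x : (x <= size a)%N -> take x a = [seq nth x0 a y | y <- iota 0 x].
Proof.
move=> xa; rewrite -{1}(mkseq_nth x0 a) /mkseq -map_take take_iota.
by rewrite (minn_idPl xa).
Qed.

End BalancedCount.

(** * Balanced words as concatenations of blocks *)

Section Concatenation.
Import mathcomp.boot.fintype mathcomp.boot.finset.
Variables (e T : nat) (g : 'I_e.+1 -> nat).
Hypothesis g_gt0 : forall i, (0 < g i)%N.

Definition block_content r (i : 'I_e.+1) : nat :=
  if (i <= r < T + i)%N then g i else 0.

Fixpoint block_words r : seq (seq 'I_e.+1) :=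
  if r is r'.+1 then
    [seq a ++ b | a <- block_words r', b <- permutations (spread (block_content r'))]
  else [:: [::]].

(** Letter [i] occurs in blocks [i] to [T + i - 1]. The truncated subtraction gives 0 before block
    [i], and the minimum stops the count after [T] blocks. *)
Lemma block_words_count r a i : a \in block_words r ->
  count_mem i a = (g i * minn T (r - i))%N.
Proof.
elim: r a => [|r IH] a.
  by rewrite inE => /eqP->; rewrite /= sub0n minn0 muln0.
case/allpairsP => -[a' b] /= [a'W + ->]; rewrite mem_permutations => /seq.permP bP.
rewrite count_cat IH // bP count_spread /block_content.
case: ifP => H; last rewrite addn0.
  by rewrite -[X in (_ + X)%N]muln1 -mulnDr; congr (_ * _)%N; lia.
by congr (_ * _)%N; lia.
Qed.

Definition seq_block (a : seq 'I_e.+1) x :=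
  (nth ord0 a x + count_mem (nth ord0 a x) (take x a) %/ g (nth ord0 a x))%N.

Lemma count_mem_take_lt (a : seq 'I_e.+1) x : (x < size a)%N ->
  (count_mem (nth ord0 a x) (take x a) < count_mem (nth ord0 a x) a)%N.
Proof.
move=> xa.
rewrite -[X in (_ < count _ X)%N](cat_take_drop x a) count_cat (drop_nth ord0 xa) /= eqxx.
lia.
Qed.

Lemma block_words_block r a : a \in block_words r ->
  (forall x, (x < size a)%N -> (seq_block a x < r)%N) /\
  (forall x y, (x < y < size a)%N -> (seq_block a x <= seq_block a y)%N).
Proof.
elim: r a => [|r IH] a.
  by rewrite inE => /eqP->; split=> // x y /andP[].
case/allpairsP => -[a' b] /= [a'W + ->]; rewrite mem_permutations => /seq.permP bP.
have [lt_r mono] := IH a' a'W.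
have left x : (x < size a')%N -> seq_block (a' ++ b) x = seq_block a' x.
  move=> xa'; rewrite /seq_block nth_cat xa' take_cat xa'; by [].
(* A letter [i] of block [r] occurred [g i * (r - i)] times before the block and fewer than [g i]
   times inside it so far, so its quotient is [r - i]. *)
have right x : (size a' <= x < size (a' ++ b))%N -> seq_block (a' ++ b) x = r.
  rewrite size_cat => /andP[a'x xs]; rewrite /seq_block nth_cat take_cat ltnNge a'x /=.
  have xb : (x - size a' < size b)%N by lia.
  have := count_mem_take_lt xb; set i := nth ord0 b _.
  rewrite bP count_spread /block_content; case: ifP => // ir lt_g.
  rewrite count_cat (block_words_count i a'W).
  rewrite mulnC divnMDl // divn_small //; lia.
split=> [x|x y]; rewrite size_cat => H.
  case: (ltnP x (size a')) => xa'; first by rewrite left // (leq_trans (lt_r x xa')).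
  by rewrite right // xa' size_cat.
case/andP: H => xy ys; case: (ltnP y (size a')) => ya'.
  have xa' := ltn_trans xy ya'.
  by rewrite !left //; apply: mono; rewrite xy.
rewrite (right y); last by rewrite ya' size_cat.
case: (ltnP x (size a')) => xa'; first by rewrite left // ltnW // lt_r.
by rewrite right // xa' size_cat (ltn_trans xy).
Qed.

Lemma block_words_size r a : a \in block_words r ->
  size a = (\sum_i g i * minn T (r - i))%N.
Proof.
by move=> aW; rewrite -sum_count_mem; apply: eq_bigr => i _; rewrite (block_words_count i aW).
Qed.

Lemma block_words_uniq r : uniq (block_words r).
Proof.
elim: r => // r IH; apply: allpairs_uniq => //; first exact: permutations_uniq.
move=> [a b] [a' b'] /allpairsP[[p q] /= [pW _ [-> ->]]].
move=> /allpairsP[[p' q'] /= [pW' _ [-> ->]]] E.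
have sE : size p = size p' by rewrite (block_words_size pW) (block_words_size pW').
by move/eqP: E; rewrite eqseq_cat // => /andP[/eqP-> /eqP->].
Qed.

(** Blocks [e] to [T - 1] contain every letter with full content and contribute one multinomial
    factor each; the remaining blocks contribute at least 1. *)
Lemma block_words_card : (size (permutations (spread g)) ^ (T - e) <=
  size (block_words (T + e)))%N.
Proof.
have step r : size (block_words r.+1) =
    (size (block_words r) * size (permutations (spread (block_content r))))%N.
  by rewrite size_allpairs.
have pos h : (0 < size (permutations (spread h)))%N.
  rewrite lt0n size_eq0; apply/eqP => E.
  by have := mem_permutations (spread h) (spread h); rewrite E perm_refl.
have full r : (e <= r < T)%N -> permutations (spread (block_content r)) = permutations (spread g).
  move=> er; congr (permutations (flatten _)); apply: eq_map => i.
  by rewrite /block_content ifT //; have := ltn_ord i; lia.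
have mono r r' : (r <= r')%N -> (size (block_words r) <= size (block_words r'))%N.
  move=> /subnK <-; elim: (r' - r)%N => // c IHc; rewrite addSn step.
  by apply: leq_trans IHc _; rewrite -[leqLHS]muln1 leq_mul2l pos orbT.
apply: leq_trans (mono T _ (leq_addr _ _)).
case: (leqP T e) => [Te|eT].
  by rewrite (eqP (_ : T - e == 0)%N) // (leq_trans _ (mono 0%N _ _)).
have H c : (e + c <= T)%N -> (size (permutations (spread g)) ^ c <= size (block_words (e + c)))%N.
  elim: c => [_|c IHc]; first by rewrite (leq_trans _ (mono 0%N _ _)).
  rewrite addnS => ecT; rewrite step expnSr full ?leq_addr //.
  by rewrite leq_mul2r IHc ?orbT // ltnW.
by have := H (T - e)%N; rewrite subnKC ?(ltnW eT) //; apply.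
Qed.

Lemma card_balanced : (size (permutations (spread g)) ^ (T - e) <=
  #|balanced (T * \sum_i g i)%N T g|)%N.
Proof.
set n := (T * _)%N; apply: leq_trans block_words_card _.
pose f (a : seq 'I_e.+1) : {ffun 'I_n -> 'I_e.+1} := [ffun x : 'I_n => nth ord0 a x].
have szE a : a \in block_words (T + e) -> size a = n.
  move=> /block_words_size->; rewrite /n big_distrr /=; apply: eq_bigr => i _.
  by rewrite mulnC (minn_idPl _) //; have := ltn_ord i; lia.
have cntE a x c : a \in block_words (T + e) -> (x <= n)%N ->
    #|[set y : 'I_n | (y < x)%N & f a y == c]| = count_mem c (take x a).
  move=> aW xn; rewrite (take_nth_iota ord0) ?(szE a aW) // count_map -(card_ord_iota _ xn).
  by apply: eq_card => y; rewrite !inE ffunE.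
rewrite -(size_map f) cardE; apply: uniq_leq_size.
  rewrite map_inj_in_uniq ?block_words_uniq // => a a' aW aW' /ffunP E.
  apply: (@eq_from_nth _ ord0); rewrite ?(szE a aW) ?(szE a' aW') // => i ni.
  by have := E (Ordinal ni); rewrite !ffunE.
move=> _ /mapP[a aW ->]; rewrite mem_enum inE; apply/andP; split.
  apply/forallP => i; rewrite /color_size.
  have := cntE a n i aW (leqnn n); rewrite take_oversize ?(szE a aW) // (block_words_count i aW).
  rewrite (_ : minn T _ = T) => [E|]; last by have := ltn_ord i; lia.
  by rewrite mulnC -E; apply/eqP; apply: eq_card => y; rewrite !inE ltn_ord.
have bE (x : 'I_n) : block g (f a) x = seq_block a x.
  rewrite /block /word_rank cntE ?(ltnW (ltn_ord x)) // ffunE.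
  by [].
apply/forallP => x; apply/forallP => y; apply/implyP => xy; rewrite !bE.
by apply: (block_words_block aW).2; rewrite xy szE //=.
Qed.

End Concatenation.

(** The factor 2 comes from choosing the two words independently; the [r] leftover points are
    appended in color 0. *)
Lemma card_colorable_lbound e T (g : 'I_e.+1 -> nat) r : (forall i, (0 < g i)%N) ->
  (size (permutations (spread g)) ^ (2 * (T - e)) <=
    #|colorable e (T * \sum_i g i + r) (T * g ord0 + r)|)%N.
Proof.
move=> g0; apply: leq_trans (card_colorableD _ _ _ _).
apply: leq_trans (card_colorable_matching _ _ g0).
by rewrite mulnC expnM leq_exp2r // card_balanced.
Qed.

Local Open Scope ring_scope.

(** * Exponential growth rates *)

(** Draw letters independently, 0 with probability [q0] and each other letter with [q1]. Since
    [q1 <= q0], every counted word has probability at least the inverse of the bound, and the total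
    probability is 1. *)
Lemma chernoff_words (R : realType) (n e : nat) (c q0 q1 : R) :
  0 < q1 -> q1 <= q0 -> q0 + e%:R * q1 = 1 ->
  #|[set w : {ffun 'I_n -> 'I_e.+1} | c * n%:R < (zeros w)%:R]|%:R
    <= expR (- (n%:R * (c * ln q0 + (1 - c) * ln q1))).
Proof.
move=> q1p q10 q_sum; have q0p := lt_le_trans q1p q10.
pose q (i : 'I_e.+1) := if i == ord0 then q0 else q1.
pose weight (w : {ffun 'I_n -> 'I_e.+1}) := \prod_t q (w t).
have weightE w : weight w = expR ((zeros w)%:R * ln q0 + (n%:R - (zeros w)%:R) * ln q1).
  rewrite /weight (bigID (fun t => w t == ord0)) /=.
  rewrite (eq_bigr (fun=> q0)) => [|t /eqP wt]; last by rewrite /q wt.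
  rewrite [X in _ * X](eq_bigr (fun=> q1)) => [|t /negPf wt]; last by rewrite /q wt.
  rewrite !prodr_const expRD.
  have zE : #|[pred t | w t == ord0]| = zeros w by rewrite /zeros cardsE.
  have nzE : #|[pred t | w t != ord0]| = (n - zeros w)%N.
    by rewrite -zE -[X in (X - _)%N]card_ord -(cardC [pred t | w t == ord0]) addKn; apply: eq_card.
  rewrite (_ : #|_| = zeros w) // (_ : #|_| = (n - zeros w)%N) //.
  rewrite -natrB; last by rewrite -zE -[leqRHS]card_ord max_card.
  by rewrite !expRM_natl !lnK ?posrE.
have weight_ge0 w : 0 <= weight w by rewrite weightE expR_ge0.
have sum1 : \sum_w weight w = 1.
  rewrite /weight -(bigA_distr_bigA (fun (_ : 'I_n) i => q i)).
  rewrite (eq_bigr (fun=> 1)) => [|t _]; first by rewrite big1.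
  rewrite (bigD1 ord0) //= {1}/q eqxx (eq_bigr (fun=> q1)) => [|i /negPf i0]; last by rewrite /q i0.
  rewrite sumr_const -mulr_natl -[RHS]q_sum; congr (_ + _%:R * _).
  by rewrite cardC1 card_ord.
rewrite expRN -div1r ler_pdivlMr ?expR_gt0 //.
rewrite -[leRHS]sum1 [leRHS](bigID
  (fun w => w \in [set w : {ffun 'I_n -> 'I_e.+1} | c * n%:R < (zeros w)%:R])) /=.
apply: ler_wpDr; first by apply: sumr_ge0.
rewrite [leLHS]mulr_natl -sumr_const; apply: ler_sum => w; rewrite inE => cw.
rewrite weightE ler_expR -subr_ge0.
have -> : (zeros w)%:R * ln q0 + (n%:R - (zeros w)%:R) * ln q1 -
    n%:R * (c * ln q0 + (1 - c) * ln q1) =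
    ((zeros w)%:R - c * n%:R) * (ln q0 - ln q1) :> R by ring.
by rewrite mulr_ge0 // subr_ge0 ?(ltW cw) // ler_ln // posrE.
Qed.

Lemma card_avoiders_ubound (R : realType) (n e : nat) :
  #|avoiders n (decreasing_perm e.+2)|%:R <= expR (2 * n%:R * ln e.+1%:R) :> R.
Proof.
have := @card_avoiders_LIS n e xpredT (fun _ _ _ => id).
rewrite (_ : finset _ = avoiders n (decreasing_perm e.+2));
  last by apply/setP => s; rewrite !inE andbT.
rewrite (_ : finset _ = [set: {ffun 'I_n -> 'I_e.+1}]); last by apply/setP => w; rewrite !inE.
rewrite finset.cardsT card_ffun !card_ord -expnM -(ler_nat R) => /le_trans; apply.
by rewrite natrX -natrM mulnC expRM_natl lnK // posrE ltr0n.
Qed.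

Lemma card_avoiders_LIS_ubound (R : realType) (n e : nat) (c q0 q1 : R) :
  0 < q1 -> q1 <= q0 -> q0 + e%:R * q1 = 1 ->
  #|[set s in avoiders n (decreasing_perm e.+2) | c * n%:R < (LIS s)%:R]|%:R
    <= expR (- (2 * n%:R * (c * ln q0 + (1 - c) * ln q1))).
Proof.
move=> q1p q10 q_sum.
have mono a b : (a <= b)%N -> c * n%:R < a%:R -> c * n%:R < b%:R.
  by move=> ab /lt_le_trans; apply; rewrite ler_nat.
have := @card_avoiders_LIS n e (fun a => c * n%:R < a%:R) mono.
rewrite -(ler_nat R) => /le_trans; apply; rewrite natrX.
rewrite -[2 * _ * _]mulrA -mulrN expRM_natl.
by rewrite ler_pXn2r ?nnegrE ?expR_ge0 //; apply: chernoff_words.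
Qed.

(** * Stirling bounds and entropy of blocks *)

Section Analysis.
Variable R : realType.
Implicit Types (x y : R).

Lemma ln_le_sub1 x : 0 < x -> ln x <= x - 1.
Proof. by move=> x0; have := @le_ln1Dx R (x - 1); rewrite subrKC; apply; lra. Qed.

Lemma ln_ge_1subV x : 0 < x -> 1 - x^-1 <= ln x.
Proof.
by move=> x0; have := @ln_le_sub1 x^-1; rewrite invr_gt0 lnV // => /(_ x0); lra.
Qed.

Lemma ln_gt_1subV x : 0 < x -> x != 1 -> 1 - x^-1 < ln x.
Proof.
move=> x0 x1; have lnx0 : - ln x != 0 by rewrite oppr_eq0 ln_eq0.
by have := expR_gt1Dx lnx0; rewrite expRN lnK //; lra.
Qed.

Lemma xlnx_tangent x y : 0 < x -> 0 < y -> (x - y) * (ln y + 1) <= x * ln x - y * ln y.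
Proof.
move=> x0 y0; have := @ln_le_sub1 (y / x); rewrite divr_gt0 // ln_div // => /(_ isT).
rewrite -(ler_pM2l x0) [X in _ <= X]mulrBr mulrCA divff ?gt_eqF // => H; lra.
Qed.

Lemma ln_factS n : ln (n.+1`!%:R) = ln n.+1%:R + ln n`!%:R :> R.
Proof. by rewrite factS natrM lnM // posrE ltr0n ?fact_gt0. Qed.

(** With [ln_fact_le], a Stirling estimate with logarithmic error, which is invisible on the
    exponential scale. *)
Lemma ln_fact_ge n : n%:R * ln n%:R - n%:R <= ln n`!%:R :> R.
Proof.
elim: n => [|n IH]; first by rewrite fact0 ln1; lra.
rewrite ln_factS; case: n IH => [_|n IH]; first by rewrite fact0 ln1; lra.
have n0 : 0 < n.+1%:R :> R by rewrite ltr0n.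
have n0' : 0 < n.+2%:R :> R by rewrite ltr0n.
have := @xlnx_tangent n.+1%:R n.+2%:R n0 n0'.
by rewrite -[n.+2%:R]natr1 in n0' IH *; lra.
Qed.

Lemma ln_fact_le n : ln n.+1`!%:R <= n.+2%:R * ln n.+1%:R - n.+1%:R + 1 :> R.
Proof.
elim: n => [|n IH]; first by rewrite -[1`!%N]/1%N ln1; lra.
rewrite ln_factS.
have n0 : 0 < n.+1%:R :> R by rewrite ltr0n.
have n0' : 0 < n.+2%:R :> R by rewrite ltr0n.
have := @ln_ge_1subV (n.+2%:R / n.+1%:R); rewrite divr_gt0 // ln_div ?posrE // => /(_ isT).
rewrite -(ler_pM2l n0') invf_div mulrBr mulrCA divff ?gt_eqF // !mulr1.
by rewrite -[n.+3%:R]natr1 -[n.+2%:R]natr1 in n0' IH *; lra.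
Qed.

(** Each of the [e.+1] factorials in the denominator costs an error of at most [ln b + 1], where [b]
    is the length of the block. *)
Lemma ln_multinomial_ge (e p m N : nat) : (0 < p)%N -> (0 < m)%N ->
  (N * (p`! * m`! ^ e))%N = (p + e * m)`! ->
  (p + e * m)%:R * ln (p + e * m)%:R - p%:R * ln p%:R - (e * m)%:R * ln m%:R
    - (e.+1)%:R * (ln (p + e * m)%:R + 1) <= ln N%:R :> R.
Proof.
move=> p0 m0 NE; set b := (p + e * m)%N in NE *.
have lnb : ln N%:R = ln b`!%:R - ln p`!%:R - e%:R * ln m`!%:R :> R.
  have N0 : (0 < N)%N by have := fact_gt0 b; rewrite -NE; case: N {NE}.
  rewrite -NE !natrM natrX !lnM ?posrE ?mulr_gt0 ?exprn_gt0 ?ltr0n ?fact_gt0 //.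
  by rewrite lnXn ?ltr0n ?fact_gt0 // mulr_natl; ring.
have := ln_fact_ge b; case: p p0 @b NE lnb => // p _ b NE lnb.
case: m m0 @b NE lnb => // m _ b NE lnb.
have := ln_fact_le p; have := ln_fact_le m.
have lnp : ln p.+1%:R <= ln b%:R :> R by rewrite ler_ln ?posrE ?ltr0n // ler_nat leq_addr.
have lnm : e%:R * ln m.+1%:R <= e%:R * ln b%:R :> R.
  case: (posnP e) => [->|e0]; first by rewrite !mul0r.
  rewrite ler_wpM2l // ler_ln ?posrE ?ltr0n // ler_nat /b; nia.
rewrite lnb.
have bE : b%:R = p.+1%:R + e%:R * m.+1%:R :> R by rewrite natrD natrM.
have -> : (e * m.+1)%:R = e%:R * m.+1%:R :> R by rewrite natrM.
rewrite -[p.+2%:R]natr1 -[m.+2%:R]natr1 -[e.+1%:R]natr1 => Hm Hp Hb.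
have Hm' : e%:R * ln m.+1`!%:R <= e%:R * ((m.+1%:R + 1) * ln m.+1%:R - m.+1%:R + 1) :> R.
  exact: ler_wpM2l.
have bb : b%:R * ln b%:R - b%:R = b%:R * ln b%:R - p.+1%:R - e%:R * m.+1%:R :> R.
  by rewrite {3}bE; ring.
lra.
Qed.

(** Replacing [x * m] by the slightly larger integer [p] loses nothing: the tangent bounds at
    [x * m + e * m] and at [p] have ordered slopes, because [p] is at most [x * m + e * m]. *)
Lemma entropy_shift (x : R) (e p m : nat) : 0 < x -> (0 < e)%N -> (0 < m)%N ->
  x * m%:R <= p%:R -> p%:R <= x * m%:R + 1 ->
  m%:R * ((x + e%:R) * ln (x + e%:R) - x * ln x) <=
  (p + e * m)%:R * ln (p + e * m)%:R - p%:R * ln p%:R - (e * m)%:R * ln m%:R.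
Proof.
move=> x0 e0 m0 xp px.
have m0' : 0 < m%:R :> R by rewrite ltr0n.
have e0' : 0 < e%:R :> R by rewrite ltr0n.
have xm0 : 0 < x * m%:R by rewrite mulr_gt0.
have p0 : 0 < p%:R :> R by lra.
have em1 : 1 <= e%:R * m%:R :> R by rewrite -natrM ler1n muln_gt0 e0.
have := @xlnx_tangent (p%:R + e%:R * m%:R) (x * m%:R + e%:R * m%:R).
have := @xlnx_tangent (x * m%:R) p%:R xm0 p0.
rewrite natrD natrM.
have E1 : ln (x * m%:R + e%:R * m%:R) = ln (x + e%:R) + ln m%:R.
  by rewrite -mulrDl lnM ?posrE //; lra.
have E2 : ln (x * m%:R) = ln x + ln m%:R by rewrite lnM ?posrE.
have H : ln p%:R <= ln (x * m%:R + e%:R * m%:R) by rewrite ler_ln ?posrE; lra.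
rewrite E2; rewrite E1 in H *.
have H' : 0 <= (p%:R - x * m%:R) * (ln (x + e%:R) + ln m%:R - ln p%:R) by apply: mulr_ge0; lra.
move=> T1 T2; have {}T2 : (p%:R + e%:R * m%:R - (x * m%:R + e%:R * m%:R)) *
     (ln (x + e%:R) + ln m%:R + 1) <=
     (p%:R + e%:R * m%:R) * ln (p%:R + e%:R * m%:R) -
     (x * m%:R + e%:R * m%:R) * (ln (x + e%:R) + ln m%:R) by apply: T2; lra.
lra.
Qed.

(** The Shannon entropy of the law giving letter 0 probability [x / (x + e)] and each of the [e]
    others [1 / (x + e)]. *)
Definition entropy (x : R) (e : nat) : R :=
  ln (x + e%:R) - x / (x + e%:R) * ln x.

Lemma entropy_ge0 x e : 1 <= x -> 0 <= entropy x e.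
Proof.
move=> x1; have e0 : 0 <= e%:R :> R by [].
have lx : 0 <= ln x by rewrite ln_ge0.
have lxe : ln x <= ln (x + e%:R) by rewrite ler_ln ?posrE; lra.
rewrite subr_ge0; apply: le_trans lxe.
by rewrite ler_piMl // ler_pdivrMr; lra.
Qed.

Lemma size_permutations_two_values e p m (g := fun i : 'I_e.+1 => if i == ord0 then p else m) :
  (size (permutations (spread g)) * (p`! * m`! ^ e))%N = (p + e * m)`! /\
  (\sum_i g i)%N = (p + e * m)%N.
Proof.
have gE : (\sum_i g i)%N = (p + e * m)%N.
  rewrite (bigD1 ord0) //= {1}/g eqxx (eq_bigr (fun=> m)) => [|i /negPf i0]; last by rewrite /g i0.
  by rewrite sum_nat_const cardC1 card_ord.
split=> //; rewrite -gE -[in RHS](eq_bigr _ (fun i _ => count_spread g i)) sum_count_mem.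
rewrite -size_permutations_multinomial; congr (_ * _)%N.
rewrite (bigD1 ord0) //= count_spread {1}/g eqxx; congr (_ * _)%N.
rewrite (eq_bigr (fun=> m`!)) => [|i /negPf i0]; last by rewrite count_spread /g i0.
by rewrite prod_nat_const cardC1 card_ord.
Qed.

Lemma exists_block x (e : nat) (eta : R) : 1 <= x -> (0 < e)%N -> 0 < eta ->
  exists p m : nat, [/\ (0 < m)%N, x * m%:R < p%:R &
    (p + e * m)%:R * (entropy x e - eta) <=
      ln (size (permutations (spread (fun i : 'I_e.+1 => if i == ord0 then p else m))))%:R].
Proof.
move=> x1 e0 eta0; have x0 : 0 < x by lra.
have K0 := entropy_ge0 e x1; set K := entropy x e in K0 *.
have e0' : 0 < e%:R :> R by rewrite ltr0n.
(* Applying [ln y <= y - 1] to [b / t] keeps the logarithmic error below [b * eta / 2] plus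
   constants. These and one letter of rounding loss are collected in [C], and [m] is chosen to make
   [C] at most [b * eta / 2]. Rounding up gives [x * m < p] strictly. *)
pose t := 2 * e.+1%:R / eta; have t0 : 0 < t by rewrite divr_gt0 // mulr_gt0.
pose C := K + e.+1%:R * (ln t + 1).
pose m := (Num.truncn (2 * C / eta)).+1.
have mC : 2 * C / eta < m%:R.
  by case: (ltP (2 * C / eta) 0) => [/lt_le_trans->//|/truncn_itv/andP[]].
pose p := (Num.truncn (x * m%:R)).+1.
have xm0 : 0 <= x * m%:R by rewrite mulr_ge0 // ltW.
have /andP[pl pu] := truncn_itv xm0.
have p1 : p%:R <= x * m%:R + 1 by rewrite -natr1 lerD2r.
exists p, m; split=> //.
have [NE _] := size_permutations_two_values e p m.
apply: le_trans (ln_multinomial_ge _ _ NE) => //.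
have := entropy_shift x0 e0 (isT : (0 < m)%N) (ltW pu) p1.
set b := (p + e * m)%N.
have b0 : 0 < b%:R :> R by rewrite ltr0n.
have KE : (x + e%:R) * ln (x + e%:R) - x * ln x = (x + e%:R) * K.
  by rewrite /K /entropy; field; lra.
rewrite KE => H1.
have bE : b%:R = p%:R + e%:R * m%:R :> R by rewrite natrD natrM.
have H2 : (b%:R - 1) * K <= m%:R * ((x + e%:R) * K).
  rewrite mulrA ler_wpM2r // bE; lra.
have H3 : ln b%:R <= b%:R / t - 1 + ln t.
  have := @ln_le_sub1 (b%:R / t); rewrite divr_gt0 // ln_div ?posrE // => /(_ isT); lra.
have H4 : e.+1%:R * (ln b%:R + 1) <= b%:R * eta / 2 + e.+1%:R * ln t.
  have -> : b%:R * eta / 2 = e.+1%:R * (b%:R / t).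
    by rewrite /t; field; rewrite gt_eqF //= lt0r_neq0.
  by rewrite -mulrDr ler_wpM2l //; lra.
have H5 : C <= b%:R * eta / 2.
  have mb : m%:R <= b%:R :> R by rewrite ler_nat /b (leq_trans _ (leq_addl _ _)) // leq_pmull.
  have : 2 * C / eta < b%:R by lra.
  by rewrite ltr_pdivrMr // => ?; lra.
have H6 : 0 <= e.+1%:R :> R by [].
move: H1 H2 H4 H5; rewrite /C; set X := _ - _ - _ * ln m%:R; move: X => X.
set Y := m%:R * _; move: Y => Y.
lra.
Qed.

End Analysis.

Local Open Scope classical_set_scope.
Local Open Scope ring_scope.

(** * Growth rates of the counts and of the deviation probability *)

Section Limit.
Variable R : realType.
Implicit Types (x c eps eta : R).

Definition large_LIS (e n : nat) c : {set 'S_n} :=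
  finset (fun s : 'S_n => (s \in avoiders n (decreasing_perm e.+2)) && (c * n%:R < (LIS s)%:R)).

Lemma card_large_LIS_lbound (e : nat) x eta : 1 <= x -> (0 < e)%N -> 0 < eta ->
  \forall n \near \oo,
    expR (2 * n%:R * (entropy x e - eta)) <= #|large_LIS e n (x / (x + e%:R))|%:R.
Proof.
move=> x1 e0 eta0.
have eta2 : 0 < eta / 2 by rewrite divr_gt0.
have e0' : 0 < e%:R :> R by rewrite ltr0n.
have [p [m [m0 xp Nlb]]] := exists_block x1 e0 eta2.
set g := (fun i => _) in Nlb; set N := size _ in Nlb; set b := (p + e * m)%N in Nlb.
have p0 : (0 < p)%N by rewrite -(ltr0n R); apply: le_lt_trans xp; rewrite mulr_ge0 //; lra.
have gE : (\sum_i g i)%N = b by have [] := size_permutations_two_values e p m.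
have g0 i : (0 < g i)%N by rewrite /g; case: ifP.
have b0 : (0 < b)%N by rewrite /b addn_gt0 p0.
have b0' : 0 < b%:R :> R by rewrite ltr0n.
have N0 : (0 < N)%N.
  have : (0 < N * (p`! * m`! ^ e))%N by rewrite (size_permutations_two_values e p m).1 fact_gt0.
  by rewrite muln_gt0 => /andP[].
have lnN : 0 <= ln N%:R :> R by rewrite ln_ge0 // ler1n.
(* Half of [eta] was spent on the block; the other half pays for at most [e.+1] lost blocks, [e] of
   them partial in content and one from the division of [n] by [b]. *)
pose n0 := (Num.truncn (2 * e.+1%:R * ln N%:R / eta)).+1.
exists n0 => // n /= n0n.
have nlarge : 2 * e.+1%:R * ln N%:R <= n%:R * eta.
  rewrite -ler_pdivrMr //; apply: (@le_trans _ _ n0%:R); last by rewrite ler_nat.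
  have : 0 <= 2 * e.+1%:R * ln N%:R / eta by rewrite divr_ge0 ?mulr_ge0 // ltW.
  by move=> /truncn_itv/andP[_ /ltW].
pose T := (n %/ b)%N; pose r := (n %% b)%N.
have nE : n = (T * b + r)%N by rewrite -divn_eq.
have nE' : n%:R = T%:R * b%:R + r%:R :> R by rewrite {1}nE natrD natrM.
have xe : 0 < x + e%:R by lra.
have sub : colorable e n (T * p + r) \subset large_LIS e n (x / (x + e%:R)).
  apply: (fintype.subset_trans (colorable_avoider _ _ _)); apply/fintype.subsetP => s.
  rewrite !inE => /andP[-> aL] /=.
  apply: (@lt_le_trans _ _ (T * p + r)%:R); last by rewrite ler_nat.
  rewrite natrD natrM mulrAC ltr_pdivrMr // nE'.
  have bE : b%:R = p%:R + e%:R * m%:R :> R by rewrite natrD natrM.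
  have n_gt0 : (0 < n)%N by apply: leq_trans n0n.
  (* This is the required inequality with denominators cleared. It is strict through [x * m < p] if
     [r] is 0, and through the leftover points of color 0 otherwise. *)
  have key : 0 < T%:R * (e%:R * (p%:R - x * m%:R)) + r%:R * e%:R.
    case: (posnP r) => [r0|r_gt0].
      have T0 : (0 < T)%N by move: n_gt0; rewrite {1}nE r0 addn0 muln_gt0 => /andP[].
      by rewrite r0 mul0r addr0 !mulr_gt0 ?ltr0n ?subr_gt0.
    by rewrite ltr_wpDl ?mulr_gt0 ?ltr0n // !mulr_ge0 // subr_ge0 ltW.
  rewrite bE; lra.
have := card_colorable_lbound T r g0; rewrite gE -nE /g eqxx -/g -/N => cl.
apply: (@le_trans _ _ (N ^ (2 * (T - e)))%:R); last first.
  by rewrite ler_nat; apply: leq_trans cl (subset_leq_card sub).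
rewrite natrX -[X in _ <= X ^+ _]lnK ?posrE ?ltr0n //.
rewrite -expRM_natl ler_expR natrM -!mulrA ler_pM2l //.
have Tn : n%:R / b%:R - 1 <= T%:R :> R.
  rewrite lerBlDr ler_pdivrMr // nE' mulrDl mul1r lerD2l ler_nat.
  by rewrite ltnW // ltn_pmod.
have Te : T%:R - e%:R <= (T - e)%:R :> R.
  by rewrite lerBlDr -natrD ler_nat addnC -leq_subLR.
have H1 : (n%:R / b%:R - e.+1%:R) * ln N%:R <= (T - e)%:R * ln N%:R :> R.
  by apply: ler_wpM2r => //; move: Tn Te; rewrite -[e.+1%:R]natr1; lra.
have H2 : n%:R * (entropy x e - eta / 2) <= n%:R / b%:R * ln N%:R.
  rewrite -mulrA ler_wpM2l // [leRHS]mulrC ler_pdivlMr // mulrC.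
  exact: Nlb.
lra.
Qed.

Lemma entropy1 e : entropy 1 e = ln e.+1%:R :> R.
Proof. by rewrite /entropy ln1 mulr0 subr0 nat1r. Qed.

(** At [x = 1] the law is uniform and the entropy maximal, so restricting to large [LIS] costs
    nothing at this scale. *)
Lemma card_avoiders_lbound (e : nat) eta : (0 < e)%N -> 0 < eta ->
  \forall n \near \oo,
    expR (2 * n%:R * (ln e.+1%:R - eta)) <= #|avoiders n (decreasing_perm e.+2)|%:R :> R.
Proof.
move=> e0 eta0; have := card_large_LIS_lbound (lexx 1) e0 eta0; rewrite entropy1.
apply: filterS => n /le_trans; apply; rewrite ler_nat; apply: subset_leq_card.
by apply/fintype.subsetP => s; rewrite inE => /andP[].
Qed.

(** The logarithm of the claimed limit, with [e] standing for [k - 2]. *)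
Definition rate (e : nat) eps : R :=
  - (2 / e.+1%:R) * ((1 + eps) * ln (1 + eps) + (e%:R - eps) * ln (1 - eps / e%:R)).

(** From [1 - 1 / y <= ln y], strict for [y] other than 1, the first product exceeds [eps] and the
    second is at least [- eps]. *)
Lemma rate_lt0 e eps : 0 < eps -> eps < e%:R -> rate e eps < 0.
Proof.
move=> eps0 epse; have e0 : 0 < e%:R :> R by lra.
rewrite /rate mulNr oppr_lt0 mulr_gt0 ?divr_gt0 //.
have p1 : 0 < 1 + eps by lra.
have p2 : 0 < 1 - eps / e%:R by rewrite subr_gt0 ltr_pdivrMr // mul1r.
have H1 : eps < (1 + eps) * ln (1 + eps).
  have e1 : 1 + eps != 1 by rewrite gt_eqF //; lra.
  by have := ln_gt_1subV p1 e1; rewrite -(ltr_pM2l p1) mulrBr divff ?gt_eqF // => H; lra.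
have H2 : - eps <= (e%:R - eps) * ln (1 - eps / e%:R).
  have ee : 0 < e%:R - eps by lra.
  have := ln_ge_1subV p2; rewrite -(ler_pM2l ee) => /(le_trans _); apply.
  by rewrite le_eqVlt; apply/orP; left; apply/eqP; field; rewrite !gt_eqF //; lra.
lra.
Qed.

Lemma avoid_prob_rate (e : nat) eps eta : 0 < eps -> eps < e%:R -> 0 < eta ->
  \forall n \near \oo,
   expR (n%:R * (rate e eps - eta)) <=
   avoid_prob R (decreasing_perm e.+2) n (fun s => (1 + eps) / e.+1%:R * n%:R < (LIS s)%:R) <=
   expR (n%:R * (rate e eps + eta)).
Proof.
move=> eps0 epse eta0.
have e0 : (0 < e)%N by rewrite -(ltr0n R); lra.
have e0' : 0 < e%:R :> R by lra.
have d0 : 0 < e.+1%:R :> R by rewrite ltr0n.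
have dE : e.+1%:R = e%:R + 1 :> R by rewrite natr1.
(* The solution of [x / (x + e) = (1 + eps) / e.+1], which is at least 1. *)
pose x := (1 + eps) * e%:R / (e%:R - eps).
have ee : 0 < e%:R - eps by lra.
have x1 : 1 <= x.
  by rewrite /x ler_pdivlMr // mul1r; nra.
have xeE : x + e%:R = e%:R * e.+1%:R / (e%:R - eps) by rewrite /x dE; field; lra.
have cE : x / (x + e%:R) = (1 + eps) / e.+1%:R.
  by rewrite xeE /x; field; rewrite !gt_eqF //=; lra.
have p1 : 0 < 1 + eps by lra.
have p2 : 0 < 1 - eps / e%:R by rewrite subr_gt0 ltr_pdivrMr // mul1r.
have xE : x = (1 + eps) / (1 - eps / e%:R) by rewrite /x; field; rewrite !gt_eqF //=; lra.
have xeE' : x + e%:R = e.+1%:R / (1 - eps / e%:R) by rewrite xeE; field; rewrite !gt_eqF //=; lra.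
have KE : 2 * (entropy x e - ln e.+1%:R) = rate e eps.
  rewrite /entropy cE /rate xeE' {1}xE !ln_div ?posrE // dE.
  by field; rewrite -dE gt_eqF.
have eta2 : 0 < eta / 2 by lra.
have lb := card_large_LIS_lbound x1 e0 eta2; rewrite cE in lb.
have lbT := card_avoiders_lbound e0 eta2.
near=> n.
have lbn : expR (2 * n%:R * (entropy x e - eta / 2)) <= #|large_LIS e n ((1 + eps) / e.+1%:R)|%:R.
  by near: n.
have lbTn : expR (2 * n%:R * (ln e.+1%:R - eta / 2)) <=
    #|avoiders n (decreasing_perm e.+2)|%:R :> R.
  by near: n.
have ubT := card_avoiders_ubound R n e.
have xe0 : 0 < x + e%:R by lra.
have ub : #|large_LIS e n ((1 + eps) / e.+1%:R)|%:R <= expR (2 * n%:R * entropy x e).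
  (* The Chernoff weights are the law whose entropy governs the lower bound, so the two exponents
     coincide. *)
  have := @card_avoiders_LIS_ubound R n e ((1 + eps) / e.+1%:R) (x / (x + e%:R)) (x + e%:R)^-1.
  rewrite invr_gt0 => /(_ xe0); rewrite -[leLHS in leLHS <= _ -> _]mul1r ler_pM2r ?invr_gt0 //.
  move=> /(_ x1); rewrite -mulrDl divff ?gt_eqF // => /(_ erefl).
  congr (_ <= expR _); rewrite -mulrN; congr (_ * _).
  rewrite ln_div ?posrE //; last lra.
  by rewrite lnV ?posrE // /entropy cE; ring.
have A0 : 0 < #|avoiders n (decreasing_perm e.+2)|%:R :> R.
  by apply: lt_le_trans lbTn; exact: expR_gt0.
rewrite /avoid_prob /uniform_prob.
have -> : finset (fun x0 : 'S_n => (x0 \in avoiders n (decreasing_perm e.+2)) &&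
   ((1 + eps) / e.+1%:R * n%:R < (LIS x0)%:R)) = large_LIS e n ((1 + eps) / e.+1%:R) by [].
apply/andP; split.
  rewrite ler_pdivlMr //; apply: le_trans lbn.
  apply: le_trans (ler_wpM2l (expR_ge0 _) ubT) _; rewrite -expRD ler_expR -KE.
  by rewrite le_eqVlt; apply/orP; left; apply/eqP; field.
rewrite ler_pdivrMr //; apply: (le_trans ub).
apply: le_trans (ler_wpM2l (expR_ge0 _) lbTn); rewrite -expRD ler_expR -KE.
by rewrite le_eqVlt; apply/orP; left; apply/eqP; field.
Unshelve. all: by end_near. Qed.

End Limit.

(** * Limit of the n-th roots, vanishing below the threshold, and convergence in probability *)

Theorem theorem2p4 (R : realType) (k : nat) (hk : (2 <= k)%N) :
  let tau : 'S_k := decreasing_perm k in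
  [/\ forall eps : R, 0 < eps -> eps < k%:R - 2 ->
        (avoid_prob R tau n
           (fun s => (1 + eps) / (k%:R - 1) * n%:R < (LIS s)%:R)) `^ (n%:R^-1)
          @[n --> \oo] -->
        (((1 + eps) `^ (1 + eps)
            * (1 - eps / (k%:R - 2)) `^ (k%:R - 2 - eps))
          `^ (- (2 / (k%:R - 1))) : R),
      forall n : nat,
        avoid_prob R tau n (fun s => (LIS s)%:R < n%:R / (k%:R - 1) :> R) = 0
    & cvg_in_avoid_prob tau
        (fun (n : nat) (s : 'S_n) => (LIS s)%:R / n%:R : R) (1 / (k%:R - 1))].
Proof.
case: k hk => [|[|e]] // _; cbv zeta.
have -> : e.+2%:R - 2 = e%:R :> R by rewrite -[e.+2%:R]natr1 -[e.+1%:R]natr1; ring.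
have -> : e.+2%:R - 1 = e.+1%:R :> R by rewrite -[e.+2%:R]natr1; ring.
have d0 : 0 < e.+1%:R :> R by rewrite ltr0n.
split.
- move=> eps eps0 epse.
  have e0 : 0 < e%:R :> R by lra.
  have p1 : 0 < 1 + eps by lra.
  have p2 : 0 < 1 - eps / e%:R by rewrite subr_gt0 ltr_pdivrMr // mul1r.
  have -> : ((1 + eps) `^ (1 + eps) * (1 - eps / e%:R) `^ (e%:R - eps)) `^ (- (2 / e.+1%:R)) =
      expR (rate e eps).
    rewrite -[LHS]lnK ?posrE ?powR_gt0 ?mulr_gt0 ?powR_gt0 //.
    by rewrite ln_powR lnM ?posrE ?powR_gt0 // !ln_powR.
  pose P n := avoid_prob R (decreasing_perm e.+2) n
    (fun s : 'S_n => (1 + eps) / e.+1%:R * n%:R < (LIS s)%:R).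
  (* The probability is eventually positive, so the power is the exponential of [ln (P n) / n]. *)
  apply: (@cvg_trans _ (expR (n%:R^-1 * ln (P n)) @[n --> \oo])).
    apply: near_eq_cvg; have := avoid_prob_rate eps0 epse ltr01; apply: filterS => n /andP[Pn _].
    by rewrite /powR gt_eqF //; apply: lt_le_trans Pn; exact: expR_gt0.
  apply: continuous_cvg; first exact: continuous_expR.
  apply/cvgrPdist_le => eta eta0.
  near=> n.
  have n0 : 0 < n%:R :> R by rewrite ltr0n; near: n; exact: nbhs_infty_gt.
  have /andP[] : expR (n%:R * (rate e eps - eta)) <= P n <= expR (n%:R * (rate e eps + eta)).
    by near: n; apply: avoid_prob_rate.
  move=> lb ub; have Pn := lt_le_trans (expR_gt0 _) lb.
  move: lb ub; rewrite -[P n]lnK ?posrE // !ler_expR !lnK ?posrE // => lb ub.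
  rewrite distrC ler_distl mulrC ler_pdivlMr // ler_pdivrMr //.
  by rewrite ![_ * n%:R]mulrC lb ub.
- move=> n; rewrite /avoid_prob /uniform_prob.
  rewrite (_ : finset _ = finset.set0) ?finset.cards0 ?mul0r //.
  apply/finset.setP => s; rewrite !inE; apply/negbTE/negP => /andP[sA].
  apply/negP; rewrite -leNgt ler_pdivrMr // -natrM ler_nat.
  by apply: avoider_LIS_ge; rewrite inE.
move=> delta delta0.
(* For avoiders [LIS / n] is at least [1 / e.+1], so every deviation is upward. *)
have dev n (s : 'S_n) : (0 < n)%N -> s \in avoiders n (decreasing_perm e.+2) ->
    delta < `|(LIS s)%:R / n%:R - 1 / e.+1%:R| ->
    (1 + delta * e.+1%:R) / e.+1%:R * n%:R < (LIS s)%:R.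
  move=> n0 /avoider_LIS_ge; rewrite -(ler_nat R) natrM -ler_pdivrMr // => sA.
  have n0' : 0 < n%:R :> R by rewrite ltr0n.
  rewrite ger0_norm; last first.
    by rewrite subr_ge0 ler_pdivlMr // mulrAC mul1r.
  rewrite ltrBrDr ltr_pdivlMr //; congr (_ * _ < _); field.
  by rewrite gt_eqF.
(* For [k = 2] the limit is 1 and no [eps] is admissible, but an upward deviation would exceed the
   trivial bound [LIS <= n]. *)
case: (posnP e) => [e0|e0].
  apply: cvg_near_cst; exists 1%N => // n /= n0.
  rewrite /avoid_prob /uniform_prob (_ : finset _ = finset.set0) ?finset.cards0 ?mul0r //.
  apply/finset.setP => s; rewrite finset.in_set finset.in_set0; apply/negbTE/negP => /andP[sA sdev].
  have := dev n s n0 sA sdev; rewrite e0 divr1 mulr1 => H.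
  have := LIS_le s; rewrite -(ler_nat R) => L.
  have : n%:R <= (1 + delta) * n%:R by rewrite ler_peMl //; lra.
  lra.
have e0' : 0 < e%:R :> R by rewrite ltr0n.
(* Capping at [e / 2] keeps [eps] admissible when [delta] is large. The rate is negative, and an
   error of half its size still leaves a geometric decay. *)
pose eps := Num.min (delta * e.+1%:R) (e%:R / 2).
have eps0 : 0 < eps by rewrite lt_min mulr_gt0 //= divr_gt0.
have epse : eps < e%:R by rewrite gt_min; apply/orP; right; lra.
have r0 := rate_lt0 eps0 epse.
have r2 : 0 < - rate e eps / 2 by lra.
apply: (@squeeze_cvgr _ _ _ _ (fun=> 0) (fun n => expR (rate e eps / 2) ^+ n)); last 2 first.
- exact: cvg_cst.
- by apply: cvg_expr; rewrite ger0_norm ?expR_ge0 // expR_lt1; lra.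
near=> n.
have n0 : (0 < n)%N by near: n; exact: nbhs_infty_gt.
apply/andP; split; first by rewrite divr_ge0.
have /andP[_] : expR (n%:R * (rate e eps - - rate e eps / 2)) <=
    avoid_prob R (decreasing_perm e.+2) n
    (fun s : 'S_n => (1 + eps) / e.+1%:R * n%:R < (LIS s)%:R) <=
    expR (n%:R * (rate e eps + - rate e eps / 2)).
  by near: n; apply: avoid_prob_rate.
rewrite (_ : rate e eps + - rate e eps / 2 = rate e eps / 2); last by field.
rewrite expRM_natl; apply: le_trans.
rewrite ler_wpM2r // ler_nat; apply: subset_leq_card; apply/fintype.subsetP => s.
rewrite finset.in_set => /andP[sA sdev]; rewrite finset.in_set sA /=.
apply: le_lt_trans (dev n s n0 sA sdev).
by rewrite ler_wpM2r // ler_wpM2r ?invr_ge0 // lerD2l ge_min lexx.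
Unshelve. all: by end_near. Qed.
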